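(* Let $c_{t_0}\in P$ be any initial noncommutative metric at an initial time $t_0\in\mathbb{R}$. Then the noncommutative Ricci flow equation \[ \frac{d}{dt}c(t) = -\triangle \log c(t) \] has a unique $C^1$ solution $c$ with values in $P$ and $c(t_0)=c_{t_0}$ on any interval $[t_0,t_1]$ with $t_1\ge t_0$, and also on $[t_0,\infty)$. Moreover, such a solution is necessarily analytic: for every $t_2\in[t_0,\infty)$ there exists $\varepsilon>0$ such that each entry of the matrix $c(t)$ is given by a convergent power series in $t-t_2$ for all $t\in[t_0,\infty)\cap(t_2-\varepsilon,t_2+\varepsilon)$.
   Context: Fix integers $n\ge 2$ and $m\in\{1,\dots,n-1\}$ with $\gcd(m,n)=1$, and put $q=e^{2\pi i m/n}$. Let $A=M_n$ be the algebra of complex $n\times n$ matrices with the conjugate-transpose involution $a\mapsto a^*$, unit $I$, and usual trace $\tau$. Let $u,v\in A$ be unitary matrices generating $A$ with $vu=quv$ (for example $u=\mathrm{diag}(1,q,\dots,q^{n-1})$ and $v$ the cyclic shift matrix with $v_{k,k+1}=1$ for $k=1,\dots,n-1$, $v_{n,1}=1$, and all other entries $0$). Choose Hermitian matrices $x,y$ with $u=e^{2\pi i x/n}$ and $v=e^{2\pi i y/n}$, and define derivations $\delta_1=[y,\cdot\,]$, $\delta_2=-[x,\cdot\,]$ on $A$. The (flat) Laplacian is the linear operator $\triangle=\delta_1^2+\delta_2^2$ on $A$, i.e. $\triangle a=[y,[y,a]]+[x,[x,a]]$. Let $P=\{a\in A: a \text{ Hermitian with all eigenvalues strictly positive}\}$;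 an element $c\in P$ is called a noncommutative metric. For $a\in P$, $\log a$ is defined by diagonalizing $a$ unitarily and applying the real logarithm to the eigenvalues. A $C^1$ function means differentiable with continuous derivative (entrywise). *)

(* Defs.v *)
(* Stdlib (classical reals).  Complex numbers are pairs of reals;
   n x n complex matrices are functions nat -> nat -> C, of which only the
   entries with indices < n are relevant (equality is [meq n]). *)
From Stdlib Require Import Reals Lra Lia Arith ClassicalEpsilon.
Open Scope R_scope.

Definition C : Type := (R * R)%type.
Definition Cre (z : C) : R := fst z.
Definition Cim (z : C) : R := snd z.
Definition Cof (r : R) : C := (r, 0).
Definition C0 : C := (0, 0).
Definition C1 : C := (1, 0).
Definition Cadd (z w : C) : C := (Cre z + Cre w, Cim z + Cim w).
Definition Copp (z : C) : C := (- Cre z, - Cim z).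
Definition Cmul (z w : C) : C :=
  (Cre z * Cre w - Cim z * Cim w, Cre z * Cim w + Cim z * Cre w).
Definition Cconj (z : C) : C := (Cre z, - Cim z).
Definition Cexpi (theta : R) : C := (cos theta, sin theta).

Definition Mat : Type := nat -> nat -> C.

Fixpoint Csum (k : nat) (f : nat -> C) : C :=
  match k with
  | O => C0
  | S k' => Cadd (Csum k' f) (f k')
  end.

Definition meq (n : nat) (A B : Mat) : Prop :=
  forall i j, (i < n)%nat -> (j < n)%nat -> A i j = B i j.
Definition mzero : Mat := fun _ _ => C0.
Definition mid : Mat := fun i j => if Nat.eq_dec i j then C1 else C0.
Definition madd (A B : Mat) : Mat := fun i j => Cadd (A i j) (B i j).
Definition mopp (A : Mat) : Mat := fun i j => Copp (A i j).
Definition msub (A B : Mat) : Mat := madd A (mopp B).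
Definition mscale (z : C) (A : Mat) : Mat := fun i j => Cmul z (A i j).
Definition mmul (n : nat) (A B : Mat) : Mat :=
  fun i j => Csum n (fun k => Cmul (A i k) (B k j)).
Definition madj (A : Mat) : Mat := fun i j => Cconj (A j i).
Definition mdiag (d : nat -> C) : Mat :=
  fun i j => if Nat.eq_dec i j then d i else C0.
Definition mvapp (n : nat) (A : Mat) (w : nat -> C) : nat -> C :=
  fun i => Csum n (fun k => Cmul (A i k) (w k)).

Definition is_unitary (n : nat) (U : Mat) : Prop :=
  meq n (mmul n (madj U) U) mid /\ meq n (mmul n U (madj U)) mid.
Definition is_hermitian (n : nat) (A : Mat) : Prop := meq n (madj A) A.

Definition is_eigenvalue (n : nat) (A : Mat) (lam : C) : Prop :=
  exists w : nat -> C, (exists i, (i < n)%nat /\ w i <> C0) /\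
    forall i, (i < n)%nat -> mvapp n A w i = Cmul lam (w i).

Definition is_pos (n : nat) (A : Mat) : Prop :=
  is_hermitian n A /\
  forall lam, is_eigenvalue n A lam -> Cim lam = 0 /\ 0 < Cre lam.

Definition diagonalizes (n : nat) (U : Mat) (lam : nat -> R) (H : Mat) : Prop :=
  is_unitary n U /\
  meq n H (mmul n (mmul n U (mdiag (fun k => Cof (lam k)))) (madj U)).

(* Functional calculus f(H) := U diag(f lam) U^*, for a chosen unitary
   diagonalization of H (if one exists; otherwise 0). *)
Definition mfun (n : nat) (f : R -> C) (H : Mat) : Mat :=
  let p := epsilon (inhabits (mzero, fun _ : nat => 0))
             (fun p : Mat * (nat -> R) => diagonalizes n (fst p) (snd p) H) in
  if excluded_middle_informative
       (exists p : Mat * (nat -> R), diagonalizes n (fst p) (snd p) H)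
  then mmul n (mmul n (fst p) (mdiag (fun k => f (snd p k)))) (madj (fst p))
  else mzero.

Definition mlog (n : nat) (a : Mat) : Mat := mfun n (fun r => Cof (ln r)) a.
Definition mexpi (n : nat) (s : R) (H : Mat) : Mat := mfun n (fun r => Cexpi (s * r)) H.

Definition generates (n : nat) (u v : Mat) : Prop :=
  forall S : Mat -> Prop,
    S mid -> S u -> S v -> S (madj u) -> S (madj v) ->
    (forall a b, S a -> S b -> S (madd a b)) ->
    (forall z a, S a -> S (mscale z a)) ->
    (forall a b, S a -> S b -> S (mmul n a b)) ->
    (forall a b, meq n a b -> S a -> S b) ->
    forall a, S a.

Definition qroot (n m : nat) : C := Cexpi (2 * PI * INR m / INR n).

Definition comm (n : nat) (a b : Mat) : Mat := msub (mmul n a b) (mmul n b a).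
Definition lap (n : nat) (x y a : Mat) : Mat :=
  madd (comm n y (comm n y a)) (comm n x (comm n x a)).

Definition is_deriv_within (I : R -> Prop) (f : R -> R) (t l : R) : Prop :=
  forall eps, 0 < eps -> exists delta, 0 < delta /\
    forall s, I s -> s <> t -> Rabs (s - t) < delta ->
      Rabs ((f s - f t) / (s - t) - l) < eps.
Definition cont_within (I : R -> Prop) (f : R -> R) (t : R) : Prop :=
  forall eps, 0 < eps -> exists delta, 0 < delta /\
    forall s, I s -> Rabs (s - t) < delta -> Rabs (f s - f t) < eps.

Definition mderiv_within (n : nat) (I : R -> Prop) (c : R -> Mat) (t : R) (D : Mat) : Prop :=
  forall i j, (i < n)%nat -> (j < n)%nat ->
    is_deriv_within I (fun s => Cre (c s i j)) t (Cre (D i j)) /\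
    is_deriv_within I (fun s => Cim (c s i j)) t (Cim (D i j)).
Definition mcont_within (n : nat) (I : R -> Prop) (c : R -> Mat) (t : R) : Prop :=
  forall i j, (i < n)%nat -> (j < n)%nat ->
    cont_within I (fun s => Cre (c s i j)) t /\
    cont_within I (fun s => Cim (c s i j)) t.
Definition is_C1_on (n : nat) (I : R -> Prop) (c : R -> Mat) : Prop :=
  exists c' : R -> Mat,
    (forall t, I t -> mderiv_within n I c t (c' t)) /\
    (forall t, I t -> mcont_within n I c' t).

Definition ricci_solution (n : nat) (x y : Mat) (I : R -> Prop) (t0 : R)
    (c0 : Mat) (c : R -> Mat) : Prop :=
  is_C1_on n I c /\
  (forall t, I t -> is_pos n (c t)) /\
  meq n (c t0) c0 /\
  (forall t, I t -> mderiv_within n I c t (mopp (lap n x y (mlog n (c t))))).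

(* Main.v *)
(* The flow is [c' = - lap (log c)] with [lap a = [y,[y,a]] + [x,[x,a]]].

   A priori bound. For nondecreasing f and g, in an eigenbasis of c,
   [tr (g(c) [h,[h,f(c)]]) = sum_ij |h_ij|^2 (f_i - f_j) (g_i - g_j) >= 0].
   With f = log and g half the derivative of the squared distance to [e, M], this shows that
   the trace of dist(c, [e, M])^2 is nonincreasing, so the spectrum of c stays in any interval
   that contains it initially.

   Uniqueness. If a and b have spectra in [e, oo), comparing their eigenbases gives
   [|log a - log b| <= |a - b| / e] in the Frobenius norm, and Gronwall's inequality applies in
   both time directions.

   Local solutions. With [c = M (1 - z)], [|z| < 1] in operator norm, the flow becomes
   [z' = - lap (sum_m z^m / m) / M].  A power series in time solves it when its coefficients
   satisfy a recursion, and in the weighted norm [sum_k |z_k| r^k] the right-hand side maps a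
   ball of radius < 1 to itself for small r; this r depends on the spectral bounds only.
   The a priori bound then lets the local solutions be continued with a fixed step, and uniqueness
   identifies every solution near any time with the analytic one centred there. *)
Require Import Defs.
From Stdlib Require Import Reals Lra.
From Stdlib Require Psatz ClassicalEpsilon.
From Coquelicot Require Rbar Lub Lim_seq Series PSeries Derive Hierarchy Continuity Rcomplements.
From mathcomp Require all_boot all_order all_algebra.
From mathcomp Require complex ring lra Rstruct.
Open Scope R_scope.

(** * Hermitian matrices and their eigenbases *)

(* The modules keep the notations of MathComp out of the statement of the theorem. *)
Module HermitianMatrices.
Import mathcomp.boot.all_boot mathcomp.order.all_order mathcomp.algebra.all_algebra.
Import mathcomp.real_closed.complex.
Import mathcomp.algebra_tactics.ring mathcomp.algebra_tactics.lra.
Import Order.TTheory GRing.Theory Num.Theory.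
#[local] Set Implicit Arguments.
#[local] Unset Strict Implicit.
#[local] Unset Printing Implicit Defensive.
Local Open Scope ring_scope.

Section HermitianMatrices.
Variables (R : rcfType).
Local Notation C := R[i].
Local Notation Re := complex.Re.
Local Notation Im := complex.Im.

(** The obstacle is that the logarithm is defined through an eigenbasis, and a basis chosen at each
    time need not depend continuously on time. So neither eigenvalues nor eigenvectors are ever
    differentiated. Two matrices with unrelated eigenbases are compared through the matrix of
    squared overlaps; being doubly stochastic, it turns a scalar inequality between eigenvalues into
    a trace inequality. This one device gives the Lipschitz bound for the logarithm, its
    independence of the diagonalization, and the first-order expansion of trace functions with a
    quadratic error. The last is enough to differentiate the squared distance to an interval, whose
    derivative is only Lipschitz.

    Two norms are needed. The Frobenius norm carries the inner product of the energy estimates. The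
    operator norm sees the spectrum exactly: eigenvalues in [[e, M]] give norm at most
    [1 - e / M < 1] for [1 - c / M], whatever the dimension, and this is what makes the logarithm
    series converge. *)

Lemma ReM (x y : C) : Re (x * y) = Re x * Re y - Im x * Im y.
Proof. by case: x => a b; case: y. Qed.
Lemma ImM (x y : C) : Im (x * y) = Re x * Im y + Im x * Re y.
Proof. by case: x => a b; case: y. Qed.
Lemma ReD (x y : C) : Re (x + y) = Re x + Re y.
Proof. by case: x => a b; case: y. Qed.
Lemma ReJ (x : C) : Re (conjc x) = Re x. Proof. by case: x. Qed.
Lemma ImJ (x : C) : Im (conjc x) = - Im x. Proof. by case: x. Qed.
Lemma Re_sum (I : Type) (r : seq I) (P : pred I) (F : I -> C) :
  Re (\sum_(i <- r | P i) F i) = \sum_(i <- r | P i) Re (F i).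
Proof. exact: (big_morph _ ReD). Qed.

Definition normsq (z : C) : R := Re z ^+ 2 + Im z ^+ 2.
Lemma normsq_ge0 z : 0 <= normsq z.
Proof. by rewrite addr_ge0 ?sqr_ge0. Qed.
Lemma mulJ_normsq (z : C) : z * conjc z = (normsq z)%:C%C.
Proof. by case: z => a b; rewrite /normsq; simpc; congr Complex; rewrite /= ?expr2; ring. Qed.

Lemma Re_dot_scale (z : C) (s t : R) :
  Re (z * s%:C%C) * Re (z * t%:C%C) + Im (z * s%:C%C) * Im (z * t%:C%C) = normsq z * (s * t).
Proof. by case: z => a b; rewrite /normsq /=; ring. Qed.

(** Lagrange's identity: twice the gap between the two sides is a double sum of squares. *)
Lemma sum_cauchy_schwarz (I : finType) (a b : I -> R) :
  (\sum_i a i * b i) ^+ 2 <= (\sum_i a i ^+ 2) * (\sum_i b i ^+ 2).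
Proof.
suff: 0 <= \sum_i \sum_j (a i * b j - a j * b i) ^+ 2.
  have -> : \sum_i \sum_j (a i * b j - a j * b i) ^+ 2 =
     2 * ((\sum_i a i ^+ 2) * (\sum_i b i ^+ 2)) - 2 * (\sum_i a i * b i) ^+ 2.
    transitivity (\sum_i \sum_j (a i ^+2 * b j ^+ 2 + b i ^+ 2 * a j ^+ 2
         - 2 * ((a i * b i) * (a j * b j)))).
      by apply: eq_bigr => i _; apply: eq_bigr => j _; ring.
    under eq_bigr do rewrite !big_split /= sumrN -!mulr_sumr.
    rewrite !big_split /= sumrN -!mulr_sumr -!mulr_suml expr2.
    ring.
  lra.
by apply: sumr_ge0 => i _; apply: sumr_ge0 => j _; apply: sqr_ge0.
Qed.

Lemma normsq_sum_le (I : finType) (a b : I -> C) :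
  normsq (\sum_i a i * b i) <= (\sum_i normsq (a i)) * (\sum_i normsq (b i)).
Proof.
have nE (z : C) : (normsq z)%:C%C = `|z| ^+ 2 by rewrite -add_Re2_Im2.
(* The modulus in [R[i]] is again a complex number; its real representative brings the claim back to
   the real inequality. *)
have [na naE] : exists na : I -> R, forall i, `|a i| = (na i)%:C%C.
  by exists (fun i => Re `|a i|) => i; rewrite RRe_real // normr_real.
have [nb nbE] : exists nb : I -> R, forall i, `|b i| = (nb i)%:C%C.
  by exists (fun i => Re `|b i|) => i; rewrite RRe_real // normr_real.
have na2 i : normsq (a i) = na i ^+ 2.
  by apply: (@complexI R); rewrite nE naE rmorphXn.
have nb2 i : normsq (b i) = nb i ^+ 2.
  by apply: (@complexI R); rewrite nE nbE rmorphXn.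
rewrite (eq_bigr _ (fun i _ => na2 i)) (eq_bigr _ (fun i _ => nb2 i)).
apply: le_trans (sum_cauchy_schwarz na nb).
rewrite -lecR nE rmorphXn /= lerXn2r // ?nnegrE.
- exact: normr_ge0.
- rewrite rmorph_sum; apply: sumr_ge0 => i _.
  by rewrite rmorphM /= -naE -nbE mulr_ge0.
rewrite rmorph_sum; apply: le_trans (ler_norm_sum _ _ _) _.
by apply: ler_sum => i _; rewrite rmorphM /= normrM naE nbE.
Qed.

Variable n : nat.
Local Notation E := 'M[C]_n.

(** * Adjoint and Frobenius inner product *)

Definition adj (A : E) : E := map_mx conjc (A^T).
(** Taking the real part makes the matrices a real Euclidean space, the natural setting for curves
    in a real time variable. *)
Definition ip (A B : E) : R := Re (\tr (A *m adj B)).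
Definition rsc (s : R) (A : E) : E := (s%:C)%C *: A.

Lemma adjE A i j : adj A i j = conjc (A j i). Proof. by rewrite !mxE. Qed.
Lemma adjK A : adj (adj A) = A.
Proof. by apply/matrixP => i j; rewrite !adjE conjcK. Qed.
Lemma adjM A B : adj (A *m B) = adj B *m adj A.
Proof. by rewrite /adj trmx_mul map_mxM. Qed.
Lemma adjD A B : adj (A + B) = adj A + adj B.
Proof. by rewrite /adj linearD map_mxD. Qed.
Lemma adjN A : adj (- A) = - adj A.
Proof. by rewrite /adj linearN map_mxN. Qed.
Lemma adjB A B : adj (A - B) = adj A - adj B.
Proof. by rewrite adjD adjN. Qed.
Lemma adjZ s A : adj (rsc s A) = rsc s (adj A).
Proof. by apply/matrixP => i j; rewrite adjE !mxE rmorphM /= oppr0. Qed.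
Lemma rscE s A i j : rsc s A i j = (s%:C)%C * A i j. Proof. by rewrite mxE. Qed.
Lemma rscDr s A B : rsc s (A + B) = rsc s A + rsc s B. Proof. exact: scalerDr. Qed.
Lemma rscBr s A B : rsc s (A - B) = rsc s A - rsc s B. Proof. exact: scalerBr. Qed.
Lemma rscA s t A : rsc s (rsc t A) = rsc (s * t) A.
Proof. by rewrite /rsc scalerA rmorphM. Qed.
Lemma rsc1 A : rsc 1 A = A. Proof. by rewrite /rsc rmorph1 scale1r. Qed.
Lemma rsc0 A : rsc 0 A = 0. Proof. by rewrite /rsc rmorph0 scale0r. Qed.
Lemma rscN1 A : rsc (-1) A = - A. Proof. by rewrite /rsc rmorphN1 scaleN1r. Qed.
Lemma rscAl s A B : rsc s A *m B = rsc s (A *m B). Proof. by rewrite /rsc scalemxAl. Qed.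
Lemma rscAr s A B : A *m rsc s B = rsc s (A *m B). Proof. by rewrite /rsc scalemxAr. Qed.
Lemma rsc_sum s (I : Type) (r : seq I) (P : pred I) (F : I -> E) :
  rsc s (\sum_(i <- r | P i) F i) = \sum_(i <- r | P i) rsc s (F i).
Proof. by rewrite /rsc scaler_sumr. Qed.

Lemma ipE A B : ip A B = \sum_i \sum_j (Re (A i j) * Re (B i j) + Im (A i j) * Im (B i j)).
Proof.
rewrite /ip /mxtrace Re_sum; apply: eq_bigr => i _.
rewrite mxE Re_sum; apply: eq_bigr => j _.
by rewrite adjE ReM ReJ ImJ; ring.
Qed.
Lemma ipC A B : ip A B = ip B A.
Proof. by rewrite !ipE; apply: eq_bigr => i _; apply: eq_bigr => j _; ring. Qed.
Lemma ipDl A B D : ip (A + B) D = ip A D + ip B D.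
Proof. by rewrite /ip mulmxDl mxtraceD ReD. Qed.
Lemma ipZl s A D : ip (rsc s A) D = s * ip A D.
Proof. by rewrite /ip rscAl /rsc mxtraceZ ReM /= mul0r subr0. Qed.
Lemma ipNl A D : ip (- A) D = - ip A D.
Proof. by rewrite -rscN1 ipZl mulN1r. Qed.
Lemma ipBl A B D : ip (A - B) D = ip A D - ip B D.
Proof. by rewrite ipDl ipNl. Qed.
Lemma ipDr A B D : ip D (A + B) = ip D A + ip D B.
Proof. by rewrite ipC ipDl !(ipC _ D). Qed.
Lemma ipBr A B D : ip D (A - B) = ip D A - ip D B.
Proof. by rewrite ipC ipBl !(ipC _ D). Qed.
Lemma ipNr A D : ip D (- A) = - ip D A.
Proof. by rewrite ipC ipNl ipC. Qed.
Lemma ipZr s A D : ip D (rsc s A) = s * ip D A.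
Proof. by rewrite ipC ipZl ipC. Qed.
Lemma ipMl A B D : ip (A *m B) D = ip B (adj A *m D).
Proof. by rewrite /ip adjM adjK -mulmxA mxtrace_mulC mulmxA. Qed.
Lemma ipMr A B D : ip (A *m B) D = ip A (D *m adj B).
Proof. by rewrite /ip adjM adjK mulmxA. Qed.
Lemma ip_adj A B : ip (adj A) (adj B) = ip A B.
Proof. by rewrite [LHS]/ip adjK mxtrace_mulC ipC. Qed.

Lemma ip_normsq A : ip A A = \sum_i \sum_j normsq (A i j).
Proof. by rewrite ipE. Qed.
Lemma ip_ge0 A : 0 <= ip A A.
Proof. by rewrite ip_normsq; do 2!(apply: sumr_ge0 => ? _); apply: normsq_ge0. Qed.
Lemma normsq_le_ip (A : E) i j : normsq (A i j) <= ip A A.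
Proof.
rewrite ip_normsq (bigD1 i) //= (bigD1 j) //= -addrA lerDl addr_ge0 //.
  by apply: sumr_ge0 => ? _; apply: normsq_ge0.
by do 2!(apply: sumr_ge0 => ? _); apply: normsq_ge0.
Qed.
Lemma ip_eq0 A : ip A A = 0 -> A = 0.
Proof.
move=> A0; apply/matrixP => i j; rewrite mxE; have := normsq_le_ip A i j.
rewrite A0 /normsq; case: (A i j) => a b /= h.
have := sqr_ge0 a; have := sqr_ge0 b => h1 h2.
have /eqP : a ^+ 2 = 0 by lra.
have /eqP : b ^+ 2 = 0 by lra.
by rewrite !sqrf_eq0 => /eqP-> /eqP->.
Qed.
Lemma ip_mul_le A B : ip (A *m B) (A *m B) <= ip A A * ip B B.
Proof.
rewrite !ip_normsq [X in _ * X]exchange_big /= mulr_suml; apply: ler_sum => i _.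
by rewrite mulr_sumr; apply: ler_sum => j _; rewrite mxE; apply: normsq_sum_le.
Qed.

(** * Unitary diagonalization and functional calculus *)

Definition unitary (U : E) := adj U *m U = 1%:M /\ U *m adj U = 1%:M.
Definition dg (l : 'I_n -> R) : E := diag_mx (\row_i ((l i)%:C)%C).
(** The spectral form of a Hermitian matrix. Functional calculus changes only the second argument:
    [f] applied to [sp U l] is [sp U (f \o l)]. *)
Definition sp (U : E) (l : 'I_n -> R) : E := U *m dg l *m adj U.

Lemma mul_dgl l (A : E) i j : (dg l *m A) i j = (l i)%:C%C * A i j.
Proof. by rewrite mul_diag_mx !mxE. Qed.
Lemma mul_dgr l (A : E) i j : (A *m dg l) i j = A i j * (l j)%:C%C.
Proof. by rewrite mul_mx_diag !mxE. Qed.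
Lemma dgE l i j : dg l i j = ((l i)%:C)%C *+ (i == j).
Proof. by rewrite !mxE. Qed.
Lemma adj_dg l : adj (dg l) = dg l.
Proof.
apply/matrixP => i j; rewrite adjE !dgE eq_sym; case: eqP => [->|_].
  by rewrite !mulr1n conjc_real.
by rewrite !mulr0n conjc0.
Qed.
Lemma dg_const s : dg (fun=> s) = rsc s 1%:M.
Proof.
apply/matrixP => i j; rewrite dgE rscE mxE.
by case: eqP => _; rewrite ?mulr1n ?mulr0n ?mulr1 ?mulr0.
Qed.
Lemma dgD f g : dg f + dg g = dg (fun i => f i + g i).
Proof. by apply/matrixP => i j; rewrite mxE !dgE -mulrnDl rmorphD. Qed.
Lemma dgZ s f : rsc s (dg f) = dg (fun i => s * f i).
Proof. by apply/matrixP => i j; rewrite rscE !dgE rmorphM mulrnAr. Qed.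
Lemma dgM f g : dg f *m dg g = dg (fun i => f i * g i).
Proof. by apply/matrixP => i j; rewrite mul_dgl !dgE rmorphM mulrnAr. Qed.

Lemma eq_sp U f g : f =1 g -> sp U f = sp U g.
Proof. by move=> fg; rewrite /sp; do 2 congr (_ *m _); apply/matrixP => i j; rewrite !dgE fg. Qed.
Lemma spD U f g : sp U f + sp U g = sp U (fun i => f i + g i).
Proof. by rewrite /sp -dgD mulmxDr mulmxDl. Qed.
Lemma spZ U s f : rsc s (sp U f) = sp U (fun i => s * f i).
Proof. by rewrite /sp -dgZ rscAr rscAl. Qed.
Lemma spN U f : - sp U f = sp U (fun i => - f i).
Proof. by rewrite -rscN1 spZ; apply: eq_sp => i; rewrite mulN1r. Qed.
Lemma spB U f g : sp U f - sp U g = sp U (fun i => f i - g i).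
Proof. by rewrite spN spD. Qed.
Lemma spM U f g : unitary U -> sp U f *m sp U g = sp U (fun i => f i * g i).
Proof.
move=> [U1 _]; rewrite /sp -dgM !mulmxA.
by rewrite -(mulmxA (U *m dg f)) U1 mulmx1.
Qed.
Lemma sp_const U s : unitary U -> sp U (fun=> s) = rsc s 1%:M.
Proof. by move=> [_ U2]; rewrite /sp dg_const rscAr rscAl mulmx1 U2. Qed.
Lemma adj_sp U f : adj (sp U f) = sp U f.
Proof. by rewrite /sp !adjM adjK adj_dg mulmxA. Qed.
Lemma spX U f m : unitary U -> (sp U f) ^+ m = sp U (fun i => f i ^+ m).
Proof.
move=> uU; elim: m => [|m IH].
  by rewrite expr0 -[LHS](rsc1) -(sp_const _ uU).
by rewrite exprS IH -mulmxE (spM _ _ uU); apply: eq_sp => i; rewrite exprS.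
Qed.

Lemma unitaryM U V : unitary U -> unitary V -> unitary (U *m V).
Proof.
move=> [a b] [c d]; split; rewrite adjM !mulmxA.
  by rewrite -(mulmxA (adj V)) a mulmx1.
by rewrite -(mulmxA U) d mulmx1.
Qed.
Lemma unitary_adj U : unitary U -> unitary (adj U).
Proof. by move=> [a b]; split; rewrite adjK. Qed.
Lemma unitary_rowsum W i : unitary W -> \sum_j normsq (W i j) = 1.
Proof.
move=> [_ /matrixP/(_ i i)]; rewrite !mxE eqxx => h.
apply: (@complexI R); rewrite rmorph_sum -[RHS]h.
by apply: eq_bigr => j _; rewrite adjE mulJ_normsq.
Qed.
Lemma unitary_colsum W j : unitary W -> \sum_i normsq (W i j) = 1.
Proof.
move/unitary_adj => /(unitary_rowsum j) <-; apply: eq_bigr => i _.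
by rewrite adjE /normsq ReJ ImJ sqrrN.
Qed.

(* The weights [|<u_i, v_j>|^2] between two eigenbases are doubly stochastic, so trace
   inequalities for pairs of functions of Hermitian matrices reduce to scalar inequalities. *)
Definition overlap (U V : E) i j := normsq ((adj U *m V) i j).

Lemma ip_sp U V f g :
  ip (sp U f) (sp V g) = \sum_i \sum_j overlap U V i j * (f i * g j).
Proof.
pose W := adj U *m V.
have -> : ip (sp U f) (sp V g) = ip (dg f *m W) (W *m dg g).
  rewrite /sp ipMr adjK ipMl [in RHS]ipMr; congr ip.
  by rewrite /W adjM adjK !mulmxA.
rewrite ipE; apply: eq_bigr => i _; apply: eq_bigr => j _.
rewrite mul_dgl mul_dgr /overlap /normsq.
rewrite !(ReM, ImM) /=; ring.
Qed.

(** Rows and columns of the overlaps sum to one, so single sums over either spectrum spread into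
    double sums and can be merged with mixed terms. *)
Lemma overlap_split U V (F : 'I_n -> R) (G : 'I_n -> R) : unitary U -> unitary V ->
  \sum_i F i + \sum_j G j = \sum_i \sum_j overlap U V i j * (F i + G j).
Proof.
move=> uU uV; have uW := unitaryM (unitary_adj uU) uV.
have -> : \sum_i \sum_j overlap U V i j * (F i + G j) =
   \sum_i \sum_j overlap U V i j * F i + \sum_i \sum_j overlap U V i j * G j.
  rewrite -big_split; apply: eq_bigr => i _; rewrite -big_split.
  by apply: eq_bigr => j _; rewrite mulrDr.
congr (_ + _).
  by apply: eq_bigr => i _; rewrite -mulr_suml unitary_rowsum // mul1r.
rewrite exchange_big; apply: eq_bigr => j _.
by rewrite -mulr_suml unitary_colsum // mul1r.
Qed.

Lemma ip_sp_same U f g : unitary U -> ip (sp U f) (sp U g) = \sum_i f i * g i.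
Proof.
move=> [U1 _]; rewrite ip_sp /overlap U1; apply: eq_bigr => i _.
rewrite (bigD1 i) //= big1 => [|j /negPf ji].
  by rewrite mxE eqxx /normsq /= expr1n expr0n /= !addr0 mul1r.
by rewrite mxE eq_sym ji /normsq /= expr0n /= addr0 mul0r.
Qed.

(** Expanding the square, the mixed term is already an overlap sum, and the two pure terms become
    one by double stochasticity. *)
Lemma ip_sp_sub U V f g : unitary U -> unitary V ->
  ip (sp U f - sp V g) (sp U f - sp V g) =
  \sum_i \sum_j overlap U V i j * (f i - g j) ^+ 2.
Proof.
move=> uU uV; rewrite ipBl !ipBr (ipC (sp V g) (sp U f)) !ip_sp_same //.
have := overlap_split (fun i => f i * f i) (fun j => g j * g j) uU uV.
move=> h; transitivity (\sum_i f i * f i + \sum_j g j * g j - 2 * ip (sp U f) (sp V g)).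
  ring.
rewrite h ip_sp mulr_sumr -sumrB; apply: eq_bigr => i _.
by rewrite mulr_sumr -sumrB; apply: eq_bigr => j _; ring.
Qed.

Lemma ip_sp_lip U V f g a b L : unitary U -> unitary V ->
  (forall i j, (f i - g j) ^+ 2 <= L * (a i - b j) ^+ 2) ->
  ip (sp U f - sp V g) (sp U f - sp V g) <= L * ip (sp U a - sp V b) (sp U a - sp V b).
Proof.
move=> uU uV h; rewrite (ip_sp_sub f g uU uV) (ip_sp_sub a b uU uV) [leRHS]mulr_sumr; apply: ler_sum => i _.
rewrite mulr_sumr; apply: ler_sum => j _; rewrite [leRHS]mulrCA.
by apply: ler_wpM2l; [exact: normsq_ge0|exact: h].
Qed.

(** Here [G] stands for a function with derivative [g]: the remainder of the first-order expansion
    of the trace of [G] at [sp U a] is an average of scalar Taylor remainders. *)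
Lemma trace_fun_expansion U V a b G g : unitary U -> unitary V ->
  \sum_j G (b j) - \sum_i G (a i) - ip (sp U (g \o a)) (sp V b - sp U a) =
  \sum_i \sum_j overlap U V i j * (G (b j) - G (a i) - g (a i) * (b j - a i)).
Proof.
move=> uU uV; rewrite ipBr ip_sp_same // ip_sp.
transitivity ((\sum_i (g (a i) * a i - G (a i)) + \sum_j G (b j))
   - \sum_i \sum_j overlap U V i j * (g (a i) * b j)).
  by rewrite sumrB /=; ring.
rewrite (overlap_split _ _ uU uV) -sumrB; apply: eq_bigr => i _.
by rewrite -sumrB; apply: eq_bigr => j _; ring.
Qed.

(** This is how trace functions get differentiated along a curve: the gradient is [g] of the matrix
    and the error is at most the squared Frobenius distance, with no regularity asked of the
    eigenvectors. *)
Lemma trace_fun_quadratic U V a b G g : unitary U -> unitary V ->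
  (forall s t : R, 0 <= G t - G s - g s * (t - s) <= (t - s) ^+ 2) ->
  0 <= \sum_j G (b j) - \sum_i G (a i) - ip (sp U (g \o a)) (sp V b - sp U a)
    <= ip (sp V b - sp U a) (sp V b - sp U a).
Proof.
move=> uU uV h; rewrite trace_fun_expansion // -[X in ip X X]opprB ipNl ipNr opprK ip_sp_sub //.
apply/andP; split.
  apply: sumr_ge0 => i _; apply: sumr_ge0 => j _; apply: mulr_ge0; first exact: normsq_ge0.
  by case/andP: (h (a i) (b j)).
apply: ler_sum => i _; apply: ler_sum => j _; apply: ler_wpM2l; first exact: normsq_ge0.
by rewrite -[(a i - _) ^+ 2]sqrrN opprB; case/andP: (h (a i) (b j)).
Qed.

Lemma hermitian_spectral A : adj A = A -> exists U l, unitary U /\ A = sp U l.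
Proof.
move=> hA; have hs : A \is hermsymmx by apply/is_hermitianmxP; rewrite expr0 scale1r; exact: esym hA.
have uP := spectral_unitarymx A.
have adjP B : adj B = (map_mx Num.conj B^T) by [].
have eA := orthomx_spectralP (hermitian_normalmx hs).
rewrite invmx_unitary // -adjP in eA; rewrite /= in eA.
have P1 : spectralmx A *m adj (spectralmx A) = 1%:M by apply/unitarymxP.
(* The rows of [spectralmx] are the eigenvectors, hence the adjoint; the diagonal is complex but
   real-valued, hence the real parts. *)
exists (adj (spectralmx A)), (fun i => Re (spectral_diag A 0 i)); split.
  by split; rewrite adjK ?P1 //; apply: mulmx1C.
have -> : sp (adj (spectralmx A)) (fun i => Re (spectral_diag A 0 i)) =
    adj (spectralmx A) *m diag_mx (spectral_diag A) *m spectralmx A.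
  rewrite /sp adjK /dg; set D := \row_i _.
  suff -> : D = spectral_diag A by [].
  apply/rowP => i; rewrite mxE RRe_real //.
  by have /mxOverP := hermitian_spectral_diag_real hs; apply.
exact: eA.
Qed.

(** * Commutators and the Laplacian *)

Definition com (h A : E) := h *m A - A *m h.
Definition lapm (x y A : E) := com y (com y A) + com x (com x A).

Lemma comD h A B : com h (A + B) = com h A + com h B.
Proof. by rewrite /com mulmxDr mulmxDl opprD addrACA. Qed.
Lemma comZ h s A : com h (rsc s A) = rsc s (com h A).
Proof. by rewrite /com rscAl rscAr rscBr. Qed.
Lemma com1 h : com h 1%:M = 0.
Proof. by rewrite /com mulmx1 mul1mx subrr. Qed.
Lemma com0 h : com h 0 = 0.
Proof. by rewrite /com mulmx0 mul0mx subrr. Qed.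
Lemma lapmD x y A B : lapm x y (A + B) = lapm x y A + lapm x y B.
Proof. by rewrite /lapm !comD addrACA. Qed.
Lemma lapmZ x y s A : lapm x y (rsc s A) = rsc s (lapm x y A).
Proof. by rewrite /lapm !comZ -rscDr. Qed.
Lemma lapm1 x y : lapm x y 1%:M = 0.
Proof. by rewrite /lapm !com1 !com0 addr0. Qed.
Lemma lapmN x y A : lapm x y (- A) = - lapm x y A.
Proof. by rewrite -!rscN1 lapmZ. Qed.
Lemma lapm0 x y : lapm x y 0 = 0.
Proof. by rewrite /lapm !com0 addr0. Qed.
Lemma adj_com h A : adj h = h -> adj (com h A) = - com h (adj A).
Proof. by move=> hh; rewrite /com adjB !adjM hh opprB. Qed.
Lemma com_opp h A : com h (- A) = - com h A.
Proof. by rewrite -!rscN1 comZ. Qed.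
Lemma adj_lapm x y A : adj x = x -> adj y = y -> adj (lapm x y A) = lapm x y (adj A).
Proof. by move=> hx hy; rewrite /lapm adjD !adj_com // !com_opp !opprK. Qed.

Lemma ip_com h A B : adj h = h -> ip A (com h B) = ip (com h A) B.
Proof.
by move=> hh; rewrite /com ipBl ipBr ipMl hh ipMr hh.
Qed.

(** By self-adjointness one commutator moves to the other argument. In the eigenbasis, the
    commutator of [H] with [dg k] has entries [H i j * (k j - k i)], so both arguments share the
    factor [H i j]. *)
Lemma ip_com_sp h U f g : adj h = h -> unitary U ->
  ip (sp U g) (com h (com h (sp U f))) =
  \sum_i \sum_j normsq ((adj U *m h *m U) i j) * ((f i - f j) * (g i - g j)).
Proof.
move=> hh [U1 U2]; rewrite ip_com //.
have comE k : com h (sp U k) = U *m com (adj U *m h *m U) (dg k) *m adj U.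
  rewrite /com /sp mulmxBr mulmxBl !mulmxA U2 mul1mx.
  by rewrite -[X in _ = _ - X]mulmxA U2 mulmx1.
rewrite !comE ipMr adjK -[_ *m adj U *m U]mulmxA U1 mulmx1 ipMl mulmxA U1 mul1mx ipE.
apply: eq_bigr => i _; apply: eq_bigr => j _; rewrite /com.
set H := adj U *m h *m U.
have e k : (H *m dg k - dg k *m H) i j = H i j * (k j - k i)%:C%C.
  by rewrite mxE mul_dgr [X in _ + X]mxE mul_dgl rmorphB mulrBr (mulrC (k i)%:C%C).
rewrite (e g) (e f) Re_dot_scale; congr (_ * _); rewrite -[RHS]mulrNN !opprB mulrC; done.
Qed.

End HermitianMatrices.
End HermitianMatrices.

Module RicciFlow.
Import Coquelicot.Rbar Coquelicot.Lub Coquelicot.Lim_seq Coquelicot.Series Coquelicot.PSeries.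
Import Coquelicot.Derive Coquelicot.Hierarchy Coquelicot.Continuity Coquelicot.Rcomplements.
Import mathcomp.boot.all_boot mathcomp.order.all_order mathcomp.algebra.all_algebra.
Import mathcomp.real_closed.complex mathcomp.reals_stdlib.Rstruct.
Import HermitianMatrices.
Import Stdlib.micromega.Lra Stdlib.micromega.Psatz Stdlib.Logic.ClassicalEpsilon.
Import Order.TTheory GRing.Theory Num.Theory.
#[local] Set Implicit Arguments.
#[local] Unset Strict Implicit.
#[local] Unset Printing Implicit Defensive.
Local Notation Re := complex.Re.
Local Notation Im := complex.Im.
Delimit Scope ring_scope with R.
Delimit Scope R_scope with coqR.
Local Open Scope R_scope.

(** * Frobenius and operator norms *)

(* A single name for the [rcfType] structure of [R], so that every occurrence of a matrix
   operation carries syntactically the same instances and [lra] can identify atoms. *)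
Definition Rf : rcfType := R.
Notation Mx n := 'M[Rf[i]]_n.
Notation ip := (@HermitianMatrices.ip Rf _).
Notation rsc := (@HermitianMatrices.rsc Rf _).
Notation adj := (@HermitianMatrices.adj Rf _).
Notation sp := (@HermitianMatrices.sp Rf _).
Notation dg := (@HermitianMatrices.dg Rf _).
Notation com := (@HermitianMatrices.com Rf _).
Notation lapm := (@HermitianMatrices.lapm Rf _).
Notation unitary := (@HermitianMatrices.unitary Rf _).
Arguments HermitianMatrices.ip {R n} (A B)%_R.
Arguments HermitianMatrices.rsc {R n} s%_coqR A%_R.
Arguments HermitianMatrices.adj {R n} A%_R.
Arguments HermitianMatrices.com {R n} (h A)%_R.
Arguments HermitianMatrices.lapm {R n} (x y A)%_R.

Section Norms.
Variable n : nat.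
Local Notation E := (Mx n).
Implicit Types A B X : E.

(** The same identities stated with the operations of the standard reals, in the form that [lra] and
    [ring] recognize. *)
Lemma ip_addl A B X : ip (A + B) X = ip A X + ip B X. Proof. exact: ipDl. Qed.
Lemma ip_addr A B X : ip X (A + B) = ip X A + ip X B. Proof. exact: ipDr. Qed.
Lemma ip_subl A B X : ip (A - B) X = ip A X - ip B X. Proof. exact: ipBl. Qed.
Lemma ip_subr A B X : ip X (A - B) = ip X A - ip X B. Proof. exact: ipBr. Qed.
Lemma ip_scall s A X : ip (rsc s A) X = s * ip A X. Proof. exact: ipZl. Qed.
Lemma ip_scalr s A X : ip X (rsc s A) = s * ip X A. Proof. exact: ipZr. Qed.
Lemma ip_oppr A X : ip X (- A) = - ip X A. Proof. exact: ipNr. Qed.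
Lemma ip_nonneg A : 0 <= ip A A. Proof. exact/RleP/ip_ge0. Qed.

Lemma normsqR (z : Rf[i]) : normsq z = Re z * Re z + Im z * Im z.
Proof. by rewrite /normsq !expr2. Qed.

Lemma Re_scal (s : R) (z : Rf[i]) : Re ((s : Rf)%:C%C * z)%R = s * Re z.
Proof. by rewrite HermitianMatrices.ReM /= mul0r subr0. Qed.
Lemma Im_scal (s : R) (z : Rf[i]) : Im ((s : Rf)%:C%C * z)%R = s * Im z.
Proof. by rewrite HermitianMatrices.ImM /= mul0r addr0. Qed.

Lemma rsc_rsc (s t : R) A : rsc s (rsc t A) = rsc (s * t) A. Proof. exact: rscA. Qed.
Lemma eq_rsc (s t : R) A : s = t -> rsc s A = rsc t A. Proof. by move->. Qed.

Definition fro A := sqrt (ip A A).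
Arguments fro A%_R.

Lemma fro_ge0 A : 0 <= fro A. Proof. exact: sqrt_pos. Qed.
Lemma fro_sqr A : fro A * fro A = ip A A.
Proof. exact/sqrt_sqrt/ip_nonneg. Qed.
Lemma fro_le A r : 0 <= r -> ip A A <= r * r -> fro A <= r.
Proof. by move=> r0 h; rewrite -(sqrt_square r) //; apply: sqrt_le_1_alt. Qed.
Lemma fro0 : fro 0 = 0.
Proof. by rewrite /fro -(rsc0 (0 : E)) ip_scall Rmult_0_l sqrt_0. Qed.
Lemma fro_eq0 A : fro A = 0 -> A = 0%R.
Proof. by move=> h; apply: ip_eq0; rewrite -fro_sqr h Rmult_0_l. Qed.
Lemma froZ s A : fro (rsc s A) = Rabs s * fro A.
Proof.
rewrite /fro ip_scall ip_scalr -Rmult_assoc sqrt_mult_alt; last exact: Rle_0_sqr.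
by rewrite -/(Rsqr s) sqrt_Rsqr_abs.
Qed.
Lemma froN A : fro (- A) = fro A.
Proof. by rewrite -rscN1 froZ -RoppE Rabs_Ropp Rabs_R1 Rmult_1_l. Qed.
Lemma fro_sym A B : fro (A - B) = fro (B - A).
Proof. by rewrite -opprB froN. Qed.
Lemma fro_adj A : fro (adj A) = fro A.
Proof. by rewrite /fro ip_adj. Qed.

Lemma ip_cauchy_schwarz A B : Rabs (ip A B) <= fro A * fro B.
Proof.
have [b0|b0] := Rle_lt_or_eq_dec _ _ (fro_ge0 B); last first.
  rewrite -b0 Rmult_0_r (fro_eq0 (esym b0)) -(rsc0 (0 : E)) ip_scalr Rmult_0_l Rabs_R0; lra.
apply: Rsqr_incr_0_var; last exact: Rmult_le_pos (fro_ge0 _) (fro_ge0 _).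
rewrite -Rsqr_abs /Rsqr.
(* The component of [A] orthogonal to [B], multiplied by [ip B B] to avoid a division; its squared
   norm is [ip B B] times the gap. *)
have := ip_nonneg (rsc (ip B B) A - rsc (ip A B) B).
rewrite ip_subl !ip_subr !ip_scall !ip_scalr (ipC B A) => h.
have bb : 0 < ip B B by rewrite -fro_sqr; apply: Rmult_lt_0_compat.
have : 0 <= ip B B * (ip A A * ip B B - ip A B * ip A B) by lra.
move=> h2; have : 0 <= ip A A * ip B B - ip A B * ip A B.
  by apply: (Rmult_le_reg_l (ip B B)); lra.
by rewrite -!fro_sqr; lra.
Qed.

Lemma fro_add A B : fro (A + B) <= fro A + fro B.
Proof.
apply: fro_le; first by have := fro_ge0 A; have := fro_ge0 B; lra.
rewrite ip_addl !ip_addr (ipC B A) -!fro_sqr.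
have := ip_cauchy_schwarz A B => /Rabs_le_between; lra.
Qed.
Lemma fro_sub A B : fro (A - B) <= fro A + fro B.
Proof. by have := fro_add A (- B); rewrite froN. Qed.
Lemma fro_dist A B X : fro (A - X) <= fro (A - B) + fro (B - X).
Proof. by have := fro_add (A - B) (B - X); rewrite addrA subrK. Qed.
Lemma fro_mul A B : fro (A *m B) <= fro A * fro B.
Proof.
apply: fro_le; first exact: Rmult_le_pos (fro_ge0 _) (fro_ge0 _).
have /RleP := ip_mul_le A B; rewrite -RmultE -!fro_sqr => h; lra.
Qed.

Lemma Re_le_fro A i j : Rabs (Re (A i j)) <= fro A.
Proof.
apply: Rsqr_incr_0_var; last exact: fro_ge0.
rewrite -Rsqr_abs /Rsqr fro_sqr.
have /RleP := normsq_le_ip A i j; rewrite normsqR.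
have := Rle_0_sqr (Im (A i j)); rewrite /Rsqr; lra.
Qed.
Lemma Im_le_fro A i j : Rabs (Im (A i j)) <= fro A.
Proof.
apply: Rsqr_incr_0_var; last exact: fro_ge0.
rewrite -Rsqr_abs /Rsqr fro_sqr.
have /RleP := normsq_le_ip A i j; rewrite normsqR.
have := Rle_0_sqr (Re (A i j)); rewrite /Rsqr; lra.
Qed.

(** The squared norm is at most [2 * n ^ 2 * e ^ 2]; the constant [2 * INR n] is a rounding up that
    avoids the root of 2. *)
Lemma fro_le_entries A e :
  (forall i j, Rabs (Re (A i j)) <= e /\ Rabs (Im (A i j)) <= e) ->
  fro A <= 2 * INR n * e.
Proof.
move=> h.
have [n0|n0] : n = 0%N \/ (0 < n)%N by case: (n); [left|right].
  suff -> : A = 0%R by rewrite fro0 n0 /=; lra.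
  by apply/matrixP => i; have := ltn_ord i; rewrite {2}n0.
have e0 : 0 <= e.
  by case: (h (Ordinal n0) (Ordinal n0)) => + _; have := Rabs_pos (Re (A (Ordinal n0) (Ordinal n0))); lra.
have nn := pos_INR n.
apply: fro_le; first by apply: Rmult_le_pos => //; lra.
have /RleP : (ip A A <= \sum_(i < n) \sum_(j < n) (e * e + e * e)%coqR)%R.
  rewrite ip_normsq; apply: ler_sum => i _; apply: ler_sum => j _.
  apply/RleP; rewrite normsqR; case: (h i j) => /Rabs_le_between h1 /Rabs_le_between h2; nra.
rewrite !sumr_const !card_ord -!mulrnA -mulr_natr natrM -INRE -!RmultE => h1.
apply: Rle_trans h1 _; nra.
Qed.

(** The boolean selects real or imaginary part, so that entrywise arguments are made once for
    both. *)
Definition coord (b : bool) (i j : 'I_n) A : R := if b then Re (A i j) else Im (A i j).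
Definition of_coords (F : bool -> 'I_n -> 'I_n -> R) : E :=
  (\matrix_(i, j) ((F true i j : Rf) +i* F false i j)%C)%R.

Lemma coord_of_coords F b i j : coord b i j (of_coords F) = F b i j.
Proof. by rewrite /coord mxE; case: b. Qed.
Lemma coord_inj A B : (forall b i j, coord b i j A = coord b i j B) -> A = B.
Proof.
move=> h; apply/matrixP => i j; have := h true i j; have := h false i j.
by rewrite /coord; case: (A i j) => ? ?; case: (B i j) => ? ? /= -> ->.
Qed.
Lemma coord_add b i j A B : coord b i j (A + B)%R = coord b i j A + coord b i j B.
Proof. by case: b; rewrite /coord mxE; case: (A i j) => ? ?; case: (B i j). Qed.
Lemma coord_scal b i j s A : coord b i j (rsc s A) = s * coord b i j A.
Proof. by rewrite /coord rscE; case: b; rewrite ?Re_scal ?Im_scal. Qed.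
Lemma coord0 b i j : coord b i j 0%R = 0.
Proof. by rewrite /coord mxE; case: b. Qed.
Lemma coord_opp b i j A : coord b i j (- A)%R = - coord b i j A.
Proof. by rewrite -rscN1 coord_scal -RoppE -R1E; lra. Qed.
Lemma coord_sub b i j A B : coord b i j (A - B)%R = coord b i j A - coord b i j B.
Proof. by rewrite coord_add coord_opp. Qed.
Lemma coord_le_fro b i j A : Rabs (coord b i j A) <= fro A.
Proof. by case: b; [exact: Re_le_fro|exact: Im_le_fro]. Qed.
Lemma fro_le_coords A e : (forall b i j, Rabs (coord b i j A) <= e) -> fro A <= 2 * INR n * e.
Proof. by move=> h; apply: fro_le_entries => i j; split; [exact: (h true)|exact: (h false)]. Qed.

(** * Operator norm *)

Definition opb A r := forall X : E, fro (A *m X) <= r * fro X.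
(** Left multiplication acts on each column separately, so this is the usual operator norm, obtained
    without introducing vectors. *)
Definition opn A : R := real (Glb_Rbar (fun r => 0 <= r /\ opb A r)).
Arguments opn A%_R.

(** The infimum is finite, since [fro A] is an admissible bound and 0 a lower one; so [real] does
    not fall back on its default value. *)
Lemma opn_glb A : is_glb_Rbar (fun r => 0 <= r /\ opb A r) (Rbar.Finite (opn A)).
Proof.
rewrite /opn; have := Glb_Rbar_correct (fun r => 0 <= r /\ opb A r).
case: (Glb_Rbar _) => [r //||] [h1 h2].
- have /h1 : 0 <= fro A /\ opb A (fro A) by split; [exact: fro_ge0|move=> X; exact: fro_mul].
  by [].
- have /h2 : is_lb_Rbar (fun r => 0 <= r /\ opb A r) (Rbar.Finite 0) by move=> r [].
  by [].
Qed.
Lemma opn_ge0 A : 0 <= opn A.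
Proof. by case: (opn_glb A) => _ h; apply: (h (Rbar.Finite 0)) => r []. Qed.
Lemma opn_le A r : 0 <= r -> opb A r -> opn A <= r.
Proof. by move=> r0 h; case: (opn_glb A) => h1 _; apply: (h1 r). Qed.
Lemma opn_mulr A X : fro (A *m X) <= opn A * fro X.
Proof.
have [x0|x0] := Rle_lt_or_eq_dec _ _ (fro_ge0 X); last first.
  by rewrite (fro_eq0 (esym x0)) mulmx0 fro0; lra.
have : fro (A *m X) / fro X <= opn A.
  case: (opn_glb A) => _ h; apply: (h (Rbar.Finite (_ / _))) => r [r0 rA] /=.
  by apply/Rle_div_l.
by move/Rle_div_l; apply.
Qed.
Lemma opn_le_fro A : opn A <= fro A.
Proof. by apply: opn_le => [|X]; [exact: fro_ge0|exact: fro_mul]. Qed.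
Lemma fro_le_opn A : fro A <= opn A * fro 1%:M.
Proof. by have := opn_mulr A 1%:M; rewrite mulmx1. Qed.
Lemma opn0 : opn 0 = 0.
Proof. by apply: Rle_antisym; [have := opn_le_fro 0; rewrite fro0|exact: opn_ge0]. Qed.
Lemma opn_add A B : opn (A + B) <= opn A + opn B.
Proof.
apply: opn_le; first by have := opn_ge0 A; have := opn_ge0 B; lra.
move=> X; rewrite mulmxDl; apply: Rle_trans (fro_add _ _) _.
by have := opn_mulr A X; have := opn_mulr B X; lra.
Qed.
Lemma opnZ s A : opn (rsc s A) <= Rabs s * opn A.
Proof.
apply: opn_le; first exact: Rmult_le_pos (Rabs_pos _) (opn_ge0 _).
move=> X; rewrite rscAl froZ Rmult_assoc; apply: Rmult_le_compat_l (Rabs_pos _) _.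
exact: opn_mulr.
Qed.
Lemma opnN A : opn (- A) <= opn A.
Proof. by have := opnZ (-1) A; rewrite Rabs_Ropp Rabs_R1 Rmult_1_l rscN1. Qed.
Lemma opn_sub A B : opn (A - B) <= opn A + opn B.
Proof. by have := opn_add A (- B); have := opnN B; lra. Qed.
Lemma opn_mul A B : opn (A *m B) <= opn A * opn B.
Proof.
apply: opn_le; first exact: Rmult_le_pos (opn_ge0 _) (opn_ge0 _).
move=> X; rewrite -mulmxA Rmult_assoc; apply: Rle_trans (opn_mulr _ _) _.
by apply: Rmult_le_compat_l (opn_ge0 _) _; exact: opn_mulr.
Qed.
(** The square of [fro (adj A *m X)] is the inner product of [X] with [A *m (adj A *m X)];
    Cauchy-Schwarz bounds it by [fro X * opn A] times that same norm, which then cancels. *)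
Lemma opn_adj A : opn (adj A) <= opn A.
Proof.
apply: opn_le (opn_ge0 _) _ => X.
have [x0|x0] := Rle_lt_or_eq_dec _ _ (fro_ge0 (adj A *m X)); last first.
  by rewrite -x0; exact: Rmult_le_pos (opn_ge0 _) (fro_ge0 _).
apply: (Rmult_le_reg_r _ _ _ x0); rewrite fro_sqr ipMl adjK ipC.
apply: Rle_trans (Rle_abs _) _; rewrite ipC.
apply: Rle_trans (ip_cauchy_schwarz _ _) _.
have h := Rmult_le_compat_l _ _ _ (fro_ge0 X) (opn_mulr A (adj A *m X)).
lra.
Qed.

(** A bound for the Laplacian in both norms: each commutator with [h] costs a factor [2 * fro h],
    and it is applied twice. *)
Definition kap (x y : E) := 4 * (fro x * fro x + fro y * fro y).
Lemma kap_ge0 x y : 0 <= kap x y.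
Proof. by rewrite /kap; have := ip_nonneg x; have := ip_nonneg y; rewrite -!fro_sqr; lra. Qed.

Lemma fro_com h A : fro (com h A) <= 2 * fro h * fro A.
Proof.
rewrite /com; apply: Rle_trans (fro_sub _ _) _.
by have := fro_mul h A; have := fro_mul A h; lra.
Qed.
Lemma opn_com h A : opn (com h A) <= 2 * fro h * opn A.
Proof.
rewrite /com; apply: Rle_trans (opn_sub _ _) _.
have := opn_mul h A; have := opn_mul A h; have := opn_le_fro h; have := opn_ge0 A.
nra.
Qed.
Lemma fro_lapm x y A : fro (lapm x y A) <= kap x y * fro A.
Proof.
have hh h : fro (com h (com h A)) <= 4 * (fro h * fro h) * fro A.
  apply: Rle_trans (fro_com _ _) _; have := fro_com h A; have := fro_ge0 h; nra.
rewrite /lapm /kap; apply: Rle_trans (fro_add _ _) _.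
by have := hh x; have := hh y; lra.
Qed.
Lemma opn_lapm x y A : opn (lapm x y A) <= kap x y * opn A.
Proof.
have hh h : opn (com h (com h A)) <= 4 * (fro h * fro h) * opn A.
  apply: Rle_trans (opn_com _ _) _; have := opn_com h A; have := fro_ge0 h; nra.
rewrite /lapm /kap; apply: Rle_trans (opn_add _ _) _.
by have := hh x; have := hh y; lra.
Qed.

Lemma fro_unitaryl (U : E) A : unitary U -> fro (U *m A) = fro A.
Proof. by case=> [U1 _]; rewrite /fro ipMl mulmxA U1 mul1mx. Qed.

(** Unitary factors preserve the Frobenius norm, and the diagonal factor scales each row. With
    [sp_le_opn], the operator norm of a Hermitian matrix is its largest absolute eigenvalue. *)
Lemma opn_sp (U : E) l r : unitary U -> 0 <= r -> (forall i, Rabs (l i) <= r) ->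
  opn (sp U l) <= r.
Proof.
move=> uU r0 h; apply: opn_le => // X.
rewrite /sp -!mulmxA fro_unitaryl //.
rewrite -(fro_unitaryl X (unitary_adj uU)); set Y := (adj U *m X)%R.
apply: fro_le; first exact: Rmult_le_pos r0 (fro_ge0 _).
have -> : r * fro Y * (r * fro Y) = r * r * ip Y Y by rewrite -fro_sqr; ring.
apply/RleP; rewrite !ip_normsq RmultE mulr_sumr; apply: ler_sum => i _.
rewrite mulr_sumr; apply: ler_sum => j _; rewrite mul_dgl !normsqR !Re_scal !Im_scal; apply/RleP.
rewrite -[X in _ <= X]/(r * r * (Re (Y i j) * Re (Y i j) + Im (Y i j) * Im (Y i j))).
have /Rabs_le_between h1 := h i.
have h2 : l i * l i <= r * r by nra.
have := Rle_0_sqr (Re (Y i j)); have := Rle_0_sqr (Im (Y i j)); rewrite /Rsqr.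
move: (Re (Y i j)) (Im (Y i j)) => a b; nra.
Qed.

Lemma sp_le_opn (U : E) l i : unitary U -> Rabs (l i) <= opn (sp U l).
Proof.
(* The product [U *m D] keeps only the [i]-th column of [U], an eigenvector for [l i]. *)
move=> uU; pose D : E := delta_mx i i.
have e : (sp U l *m (U *m D) = rsc (l i) (U *m D)%R)%R.
  rewrite /sp -rscAr -!mulmxA; congr mulmx; case: (uU) => U1 _.
  rewrite [(adj U *m _)%R]mulmxA U1 mul1mx; apply/matrixP => k j.
  by rewrite mul_dgl rscE !mxE; case: eqP => [->//|]; rewrite !mulr0.
have := opn_mulr (sp U l) (U *m D); rewrite e froZ fro_unitaryl //.
have d0 : 0 < fro D.
  have := Re_le_fro D i i; rewrite mxE !eqxx /= Rabs_R1; lra.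
by apply: Rmult_le_reg_r.
Qed.

End Norms.
Arguments fro {n} A%_R.
Arguments opn {n} A%_R.

(** * Series of matrices *)

Fixpoint rsum (x : nat -> R) (N : nat) : R :=
  if N is N'.+1 then rsum x N' + x N' else 0.

Lemma rsumE x N : rsum x N = (\sum_(k < N) (x k : Rf))%R.
Proof. by elim: N => [|N IH]; rewrite ?big_ord0 // big_ord_recr /= -IH. Qed.
Lemma rsum_sum_n x N : sum_n x N = rsum x N.+1.
Proof.
elim: N => [|N IH]; first by rewrite sum_O /= Rplus_0_l.
by rewrite sum_Sn IH.
Qed.
Lemma rsum_le x y N : (forall k, x k <= y k) -> rsum x N <= rsum y N.
Proof. by move=> h; elim: N => [|N IH] /=; [lra|have := h N; lra]. Qed.
Lemma eq_rsum x y N : (forall k, (k < N)%N -> x k = y k) -> rsum x N = rsum y N.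
Proof.
elim: N => [//|N IH] h /=; rewrite (h N (ltnSn N)) IH // => k kN.
by apply: h; apply: ltnW.
Qed.
Lemma rsum_ge0 x N : (forall k, 0 <= x k) -> 0 <= rsum x N.
Proof. by move=> h; elim: N => [|N IH] /=; [lra|have := h N; lra]. Qed.
Lemma rsum_scal c x N : rsum (fun k => c * x k) N = c * rsum x N.
Proof. by elim: N => [|N IH] /=; [ring|rewrite IH; ring]. Qed.
Lemma rsum_shift x N : rsum x N.+1 = x 0%N + rsum (fun k => x k.+1) N.
Proof. by elim: N => [|N IH] /=; [ring|rewrite -Rplus_assoc -IH]. Qed.
Lemma rsum_term x N k : (forall k, 0 <= x k) -> (k < N)%N -> x k <= rsum x N.
Proof.
move=> h; elim: N => [//|N IH] /=; rewrite ltnS leq_eqVlt => /orP[/eqP->|/IH].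
  by have := rsum_ge0 N h; lra.
by have := h N; lra.
Qed.
Lemma rsum_geom q N : 0 <= q < 1 -> rsum (fun m => q ^ m) N <= / (1 - q).
Proof.
move=> hq; suff -> : rsum (fun m => q ^ m) N = (1 - q ^ N) / (1 - q).
  rewrite -[X in _ <= X]Rmult_1_l; apply: Rmult_le_compat_r.
    by apply/Rlt_le/Rinv_0_lt_compat; lra.
  by have := pow_le q N (proj1 hq); lra.
elim: N => [|N IH] /=; first by field; lra.
by rewrite IH; field; lra.
Qed.
Lemma ex_series_bounded x B : (forall k, 0 <= x k) -> (forall N, rsum x N <= B) ->
  ex_series x.
Proof.
move=> h hB; have [l hl] : ex_finite_lim_seq (sum_n x).
  apply: (ex_finite_lim_seq_incr _ B) => N; rewrite !rsum_sum_n //=.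
    by have := h N.+1; rewrite /=; lra.
  exact: (hB N.+1).
by exists l.
Qed.
Lemma is_series_rsum x l : is_series x l <-> is_lim_seq (rsum x) l.
Proof.
have -> : is_series x l = is_lim_seq (sum_n x) l by [].
rewrite (is_lim_seq_incr_1 (rsum x)).
by split; apply: is_lim_seq_ext => N; rewrite rsum_sum_n.
Qed.

(** The Cauchy product sums over the triangle [i + j < N] of the square of all pairs. It is stated
    over any ring because the remainder for matrices will be dominated by the same remainder for
    their norms. *)
Lemma cauchy_product_remainder (T : pzRingType) (f g : nat -> T) N :
  ((\sum_(i < N) f i) * (\sum_(j < N) g j) - \sum_(k < N) \sum_(j < k.+1) f j * g (k - j)%N
   = \sum_(i < N) \sum_(j < N | (N <= i + j)%N) f i * g j)%R.
Proof.
have -> : (\sum_(k < N) \sum_(j < k.+1) f j * g (k - j)%N =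
   \sum_(i < N) \sum_(j < N | (i + j < N)%N) f i * g j)%R.
  transitivity (\sum_(k < N) \sum_(j < N | (j <= k)%N) f j * g (k - j)%N)%R.
    apply: eq_bigr => k _.
    by rewrite (big_ord_widen N (fun j => f j * g (k - j)%N)%R (ltn_ord k)).
  rewrite (exchange_big_dep predT) //=; apply: eq_bigr => i _.
  rewrite -(big_mkord (fun k => (i <= k)%N) (fun k => f i * g (k - i)%N)%R).
  rewrite -(big_mkord (fun j => (i + j < N)%N) (fun j => f i * g j)%R).
  have -> : (\sum_(0 <= k < N | (i <= k)%N) f i * g (k - i)%N =
     \sum_(i <= k < N) f i * g (k - i)%N)%R.
    rewrite (big_cat_nat (n := i)) ?(ltnW (ltn_ord i)) //= big_nat_cond big1 ?add0r; last first.
      by move=> k /andP[/andP[_ ki]]; rewrite leqNgt ki.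
    by rewrite big_nat_cond [RHS]big_nat_cond; apply: eq_bigl => k; case: (i <= k)%N.
  rewrite -{1}[(i : nat)]add0n big_addn.
  rewrite [RHS](big_cat_nat (n := (N - i)%N)) ?leq_subr //= [X in (_ + X)%R]big_nat_cond.
  rewrite [X in (_ + X)%R]big1 ?addr0; last first.
    by move=> j /andP[/andP[+ _]]; rewrite leq_subLR => h1; rewrite ltnNge h1.
  rewrite big_nat_cond [RHS]big_nat_cond; apply: eq_big => j.
    by rewrite ltn_subRL addnC; case: (_ < N)%N; rewrite ?andbF.
  by rewrite addnK.
rewrite mulr_suml -sumrB; apply: eq_bigr => i _; rewrite mulr_sumr.
rewrite (bigID (fun j : 'I_N => (i + j < N)%N)) /= addrAC subrr add0r.
by apply: eq_bigl => j; rewrite -leqNgt.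
Qed.

Definition rconv (x y : nat -> R) (k : nat) : R := sum_f_R0 (fun j => x j * y (k - j)%N) k.
Lemma rconvE x y k : rconv x y k = (\sum_(j < k.+1) (x j : Rf) * y (k - j)%N)%R.
Proof. by rewrite /rconv sum_f_R0E big_mkord. Qed.
Lemma rconv_remainder x y N : rsum x N * rsum y N - rsum (rconv x y) N =
  (\sum_(i < N) \sum_(j < N | (N <= i + j)%N) (x i : Rf) * y j)%R.
Proof.
rewrite -(cauchy_product_remainder (T := Rf)) !rsumE; congr (_ - _).
by apply: eq_bigr => k _; rewrite rconvE.
Qed.
Lemma rsum_rconv_le x y N : (forall k, 0 <= x k) -> (forall k, 0 <= y k) ->
  rsum (rconv x y) N <= rsum x N * rsum y N.
Proof.
move=> hx hy; suff : 0 <= rsum x N * rsum y N - rsum (rconv x y) N by lra.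
rewrite rconv_remainder; apply/RleP; apply: sumr_ge0 => i _; apply: sumr_ge0 => j _.
by apply: mulr_ge0; apply/RleP.
Qed.

Lemma is_lim_seq_bigsum (I : Type) (s : seq I) (f : nat -> I -> Rf) (l : I -> Rf) :
  (forall i, is_lim_seq (fun L => f L i) (l i)) ->
  is_lim_seq (fun L => \sum_(i <- s) f L i)%R (\sum_(i <- s) l i)%R.
Proof.
move=> h; elim: s => [|i s IH].
  rewrite big_nil; apply: (is_lim_seq_ext (fun=> 0)); last exact: is_lim_seq_const.
  by move=> L; rewrite big_nil.
rewrite big_cons; apply: (is_lim_seq_ext (fun L => f L i + (\sum_(i <- s) f L i)%R)).
  by move=> L; rewrite big_cons.
exact: is_lim_seq_plus'.
Qed.

Section Series.
Variable n : nat.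
Local Notation E := (Mx n).
Implicit Types (A B : E) (u f g : nat -> E).

Definition mlim u A := is_lim_seq (fun L => fro (u L - A)) 0.

Lemma mlim_le u A (phi : nat -> R) : (forall L, fro (u L - A) <= phi L) ->
  is_lim_seq phi 0 -> mlim u A.
Proof.
move=> h hphi; apply: (is_lim_seq_le_le (fun=> 0) _ phi) => //; last exact: is_lim_seq_const.
by move=> L; split; [exact: fro_ge0|exact: h].
Qed.
Lemma mlim_ext u v A : u =1 v -> mlim u A -> mlim v A.
Proof. by move=> uv; apply: is_lim_seq_ext => L; rewrite uv. Qed.
Lemma mlim_const A : mlim (fun=> A) A.
Proof. by apply: (is_lim_seq_ext (fun=> 0)); [move=> L; rewrite subrr fro0|exact: is_lim_seq_const]. Qed.
Lemma mlim_incr u A : mlim (fun L => u L.+1) A <-> mlim u A.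
Proof. by rewrite /mlim (is_lim_seq_incr_1 (fun L => fro (u L - A))). Qed.
Lemma mlim_unique u A B : mlim u A -> mlim u B -> A = B.
Proof.
move=> hA hB; apply/eqP; rewrite -subr_eq0; apply/eqP/fro_eq0.
apply: Rle_antisym; last exact: fro_ge0.
have h := is_lim_seq_plus' _ _ _ _ hA hB; rewrite Rplus_0_l in h.
apply: (is_lim_seq_le (fun=> fro (A - B)) _ (fro (A - B)) 0 _ (is_lim_seq_const _) h) => L.
by rewrite (fro_sym (u L) A); apply: fro_dist.
Qed.
Lemma mlimD u v A B : mlim u A -> mlim v B -> mlim (fun L => u L + v L)%R (A + B)%R.
Proof.
move=> hA hB; have := is_lim_seq_plus' _ _ _ _ hA hB; rewrite Rplus_0_l.
by apply: mlim_le => L; rewrite opprD addrACA; apply: fro_add.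
Qed.
Lemma mlim_lip (F : E -> E) K u A : (forall X Y, fro (F X - F Y) <= K * fro (X - Y)) ->
  mlim u A -> mlim (fun L => F (u L)) (F A).
Proof.
move=> h hu; apply: (mlim_le (phi := fun L => K * fro (u L - A))) => [L|]; first exact: h.
by have := is_lim_seq_scal_l _ K 0 hu; rewrite /= Rmult_0_r.
Qed.
Lemma mlimZ s u A : mlim u A -> mlim (fun L => rsc s (u L)) (rsc s A).
Proof. by apply: (mlim_lip (K := Rabs s)) => X Y; rewrite -rscBr froZ; exact: Rle_refl. Qed.
Lemma mlimB u v A B : mlim u A -> mlim v B -> mlim (fun L => u L - v L)%R (A - B)%R.
Proof.
move=> hA hB; rewrite -rscN1; apply: mlim_ext (mlimD hA (mlimZ (-1) hB)) => L.
by rewrite rscN1.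
Qed.
Lemma mlim_fro u A : mlim u A -> is_lim_seq (fun L => fro (u L)) (fro A).
Proof.
move=> h; have h1 := is_lim_seq_plus' _ _ _ _ h (is_lim_seq_const (fro A)).
have h2 := is_lim_seq_minus' _ _ _ _ (is_lim_seq_const (fro A)) h.
rewrite Rplus_0_l in h1; rewrite Rminus_0_r in h2.
apply: is_lim_seq_le_le h2 h1 => L; split.
  by have := fro_dist A (u L) 0; rewrite !subr0 (fro_sym A); lra.
by have := fro_dist (u L) A 0; rewrite !subr0.
Qed.
Lemma mlim_mul u v A B : mlim u A -> mlim v B -> mlim (fun L => u L *m v L)%R (A *m B)%R.
Proof.
move=> hA hB.
apply: (mlim_le (phi := fun L => fro (u L - A) * fro (v L) + fro A * fro (v L - B))) => [L|].
  have -> : (u L *m v L - A *m B = (u L - A) *m v L + A *m (v L - B))%R.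
    by rewrite mulmxBl mulmxBr addrA subrK.
  apply: Rle_trans (fro_add _ _) _.
  by have := fro_mul (u L - A) (v L); have := fro_mul A (v L - B); lra.
have := is_lim_seq_plus' _ _ _ _ (is_lim_seq_mult' _ _ _ _ hA (mlim_fro hB))
   (is_lim_seq_mult' _ _ _ _ (is_lim_seq_const (fro A)) hB).
by rewrite Rmult_0_l Rmult_0_r Rplus_0_l.
Qed.
Lemma mlim_opn u A : mlim u A -> is_lim_seq (fun L => opn (u L)) (opn A).
Proof.
move=> h; have h1 := is_lim_seq_plus' _ _ _ _ h (is_lim_seq_const (opn A)).
have h2 := is_lim_seq_minus' _ _ _ _ (is_lim_seq_const (opn A)) h.
rewrite Rplus_0_l in h1; rewrite Rminus_0_r in h2.
apply: is_lim_seq_le_le h2 h1 => L; split.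
  have := opn_add (u L) (A - u L); rewrite addrC subrK.
  by have := opn_le_fro (A - u L); rewrite fro_sym; lra.
have := opn_add A (u L - A); rewrite addrC subrK.
by have := opn_le_fro (u L - A); lra.
Qed.

Lemma mlim_coord u A b i j : mlim u A -> is_lim_seq (fun L => coord b i j (u L)) (coord b i j A).
Proof.
move=> h; have h0 := is_lim_seq_const (coord b i j A).
have h1 := is_lim_seq_plus' _ _ _ _ h0 h.
have h2 := is_lim_seq_minus' _ _ _ _ h0 h.
rewrite Rplus_0_r in h1; rewrite Rminus_0_r in h2.
apply: is_lim_seq_le_le h2 h1 => L.
have := coord_le_fro b i j (u L - A); rewrite coord_sub => /Rabs_le_between h3; split; lra.
Qed.
Lemma mlim_coords u A :
  (forall b i j, is_lim_seq (fun L => coord b i j (u L)) (coord b i j A)) -> mlim u A.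
Proof.
move=> h.
(* The sum of all coordinate errors dominates each of them and still tends to zero, since there are
   finitely many. *)
pose S L : Rf := (\sum_(b : bool) \sum_(i < n) \sum_(j < n) (Rabs (coord b i j (u L - A)) : Rf))%R.
apply: (mlim_le (phi := fun L => 2 * INR n * S L)) => [L|].
  apply: fro_le_coords => b i j; apply/RleP; rewrite /S.
  rewrite (bigD1 b) //= (bigD1 i) //= (bigD1 j) //= -!addrA lerDl.
  by rewrite !addr_ge0 //; do ?[apply: sumr_ge0 => ? _]; apply/RleP/Rabs_pos.
have : is_lim_seq S (\sum_(b : bool) \sum_(i < n) \sum_(j < n) (0 : Rf))%R.
  apply: is_lim_seq_bigsum => b; apply: is_lim_seq_bigsum => i; apply: is_lim_seq_bigsum => j.
  have h1 := is_lim_seq_minus' _ _ _ _ (h b i j) (is_lim_seq_const (coord b i j A)).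
  apply: (is_lim_seq_ext (fun L => Rabs (coord b i j (u L) - coord b i j A))) => [L|].
    by rewrite coord_sub.
  have := is_lim_seq_abs _ _ h1; rewrite /= Rminus_diag Rabs_R0; exact.
rewrite big1; last by move=> *; apply: big1 => *; apply: big1.
by move=> hS; have := is_lim_seq_scal_l _ (2 * INR n) 0 hS; rewrite /= Rmult_0_r.
Qed.

Fixpoint psum f N : E := if N is N'.+1 then (psum f N' + f N')%R else 0%R.

Lemma psumE f N : psum f N = (\sum_(k < N) f k)%R.
Proof. by elim: N => [|N IH]; rewrite ?big_ord0 // big_ord_recr /= -IH. Qed.
Lemma coord_psum f b i j N : coord b i j (psum f N) = rsum (fun k => coord b i j (f k)) N.
Proof. by elim: N => [|N IH] /=; rewrite ?coord0 // coord_add IH. Qed.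
Lemma opn_psum f N : opn (psum f N) <= rsum (fun k => opn (f k)) N.
Proof.
elim: N => [|N IH] /=; first by rewrite opn0; lra.
by apply: Rle_trans (opn_add _ _) _; lra.
Qed.
Lemma psumD f g N : psum (fun k => f k + g k)%R N = (psum f N + psum g N)%R.
Proof. by elim: N => [|N IH] /=; rewrite ?addr0 // IH addrACA. Qed.
Lemma psum_lin (F : E -> E) f N : F 0%R = 0%R -> (forall X Y, F (X + Y) = F X + F Y)%R ->
  psum (fun k => F (f k)) N = F (psum f N).
Proof. by move=> F0 FD; elim: N => [|N IH] /=; rewrite ?F0 // FD IH. Qed.
Lemma psum_ext f g N : f =1 g -> psum f N = psum g N.
Proof. by move=> fg; elim: N => [|N IH] //=; rewrite fg IH. Qed.

Definition mser f S := mlim (psum f) S.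
(** [Series] is total, so this is defined for every family of matrices; it is the sum of the series
    once convergence is known, as in [mser_msum]. *)
Definition msum f : E := of_coords (fun b i j => Series (fun k => coord b i j (f k))).

Lemma msum_ext f g : f =1 g -> msum f = msum g.
Proof.
move=> fg; apply: coord_inj => b i j; rewrite !coord_of_coords.
by apply: Series_ext => k; rewrite fg.
Qed.
Lemma mser_ext f g S : f =1 g -> mser f S -> mser g S.
Proof. by move=> fg; apply: mlim_ext => N; apply: psum_ext. Qed.
Lemma mser_coord f S b i j : mser f S -> is_series (fun k => coord b i j (f k)) (coord b i j S).
Proof.
move=> h; apply/is_series_rsum; apply: (is_lim_seq_ext (fun N => coord b i j (psum f N))); last exact: mlim_coord.
by move=> N; exact: coord_psum.
Qed.
Lemma mser_msum f (x : nat -> R) : (forall k, fro (f k) <= x k) -> ex_series x ->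
  mser f (msum f).
Proof.
move=> h hx; apply: mlim_coords => b i j; rewrite coord_of_coords.
apply: (is_lim_seq_ext (rsum (fun k => coord b i j (f k)))) => [N|].
  by rewrite coord_psum.
apply/is_series_rsum/Series_correct/(ex_series_le _ x) => // k.
by apply: Rle_trans (h k); apply: coord_le_fro.
Qed.
Lemma mser_lip (F : E -> E) K f S : F 0%R = 0%R -> (forall X Y, F (X + Y) = F X + F Y)%R ->
  (forall X, fro (F X) <= K * fro X) -> mser f S -> mser (fun k => F (f k)) (F S).
Proof.
move=> F0 FD FK h.
have FB X Y : (F (X - Y) = F X - F Y)%R.
  by have := FD (X - Y)%R Y; rewrite subrK => ->; rewrite addrK.
apply: (mlim_ext (u := fun N => F (psum f N))) => [N|]; first by rewrite psum_lin.
by apply: (mlim_lip (K := K)) h => X Y; rewrite -FB.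
Qed.
Lemma mserD f g S T : mser f S -> mser g T -> mser (fun k => f k + g k)%R (S + T)%R.
Proof. by move=> hf hg; apply: mlim_ext (mlimD hf hg) => N; rewrite psumD. Qed.
Lemma mserZ s f S : mser f S -> mser (fun k => rsc s (f k)) (rsc s S).
Proof.
apply: (mser_lip (K := Rabs s)) => [|X Y|X].
- by rewrite /HermitianMatrices.rsc scaler0.
- exact: rscDr.
- by rewrite froZ; lra.
Qed.
Lemma mser_lapm x y f S : mser f S -> mser (fun k => lapm x y (f k)) (lapm x y S).
Proof. by apply: (mser_lip (K := kap x y)) => [|X Y|X]; [exact: lapm0|exact: lapmD|exact: fro_lapm]. Qed.
Lemma mser_adj f S : mser f S -> mser (fun k => adj (f k)) (adj S).
Proof.
apply: (mser_lip (K := 1)) => [|X Y|X].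
- by have := adjB (0 : E) 0; rewrite !subrr.
- exact: adjD.
- by rewrite fro_adj; lra.
Qed.
Lemma mser_opn_le f S (B : R) : mser f S -> (forall N, rsum (fun k => opn (f k)) N <= B) -> opn S <= B.
Proof.
move=> h hB; have := is_lim_seq_le (fun N => opn (psum f N)) (fun=> B) (opn S) B.
apply; [|exact: mlim_opn h|exact: is_lim_seq_const].
by move=> N; apply: Rle_trans (opn_psum _ _) (hB N).
Qed.

Definition conv f g (k : nat) : E := (\sum_(j < k.+1) f j *m g (k - j)%N)%R.

Lemma opn_conv f g k : opn (conv f g k) <= rconv (fun k => opn (f k)) (fun k => opn (g k)) k.
Proof.
rewrite rconvE /conv; elim/big_rec2: _ => [|i a b _ h]; first by rewrite opn0; exact: Rle_refl.
apply: Rle_trans (opn_add _ _) _.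
by apply: Rplus_le_compat => //; apply: opn_mul.
Qed.

Lemma mser_conv f g A B : ex_series (fun k => fro (f k)) -> ex_series (fun k => fro (g k)) ->
  mser f A -> mser g B -> mser (conv f g) (A *m B)%R.
Proof.
move=> ef eg hf hg.
have hAB := mlim_mul hf hg.
pose x k := fro (f k); pose y k := fro (g k).
have xge0 k : 0 <= x k by apply: fro_ge0.
have yge0 k : 0 <= y k by apply: fro_ge0.
(* The sum of [fro (f i) * fro (g j)] over the pairs of the square with [N <= i + j]. It vanishes in
   the limit by the scalar theorem on Cauchy products and dominates the matrix remainder. *)
pose D N := rsum x N * rsum y N - rsum (rconv x y) N.
have hD : is_lim_seq D 0.
  have hx := Series_correct _ ef; have hy := Series_correct _ eg.
  have ea z : (forall k, 0 <= z k) -> ex_series z -> ex_series (fun k => Rabs (z k)).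
    by move=> z0; apply: ex_series_ext => k; rewrite Rabs_pos_eq.
  have := is_series_mult x y _ _ hx hy (ea _ xge0 ef) (ea _ yge0 eg).
  move=> /is_series_rsum h; move/is_series_rsum: hx => hx; move/is_series_rsum: hy => hy.
  have := is_lim_seq_minus' _ _ _ _ (is_lim_seq_mult' _ _ _ _ hx hy) h.
  by rewrite Rminus_diag.
have hR : mlim (fun N => psum f N *m psum g N - psum (conv f g) N)%R 0%R.
  apply: (mlim_le (phi := D)) hD => N; rewrite subr0 /D rconv_remainder.
  have -> : (psum f N *m psum g N - psum (conv f g) N =
     \sum_(i < N) \sum_(j < N | (N <= i + j)%N) f i *m g j)%R.
    by rewrite !psumE; apply: (cauchy_product_remainder (T := E)).
  elim/big_rec2: _ => [|i a b _ h]; first by rewrite fro0; exact: Rle_refl.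
  apply: Rle_trans (fro_add _ _) _; apply: Rplus_le_compat => //.
  elim/big_rec2: _ => [|j a' b' _ h']; first by rewrite fro0; exact: Rle_refl.
  by apply: Rle_trans (fro_add _ _) _; apply: Rplus_le_compat => //; apply: fro_mul.
have := mlimB hAB hR; rewrite subr0; apply: mlim_ext => N.
by rewrite opprB addrC subrK.
Qed.
End Series.

(** * Power series with matrix coefficients *)

Lemma lt_CV_radius (a : nat -> R) (r B s : R) : 0 <= r ->
  (forall k, Rabs (a k) * r ^ k <= B) -> Rabs s < r -> Rbar_lt (Rabs s) (CV_radius a).
Proof.
move=> r0 h hs; apply: (Rbar_lt_le_trans _ (Rbar.Finite r)) => //.
apply: (proj1 (CV_radius_bounded a)); exists B => k.
by rewrite Rabs_mult (Rabs_pos_eq (r ^ k)) //; apply: pow_le.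
Qed.

(** The derivative of the power series is the geometric series, so its sum with [ln (1 - t)] has
    derivative zero on the unit interval around 0, and it vanishes at 0. *)
Lemma log_series (s : R) : Rabs s < 1 ->
  is_series (fun m => / INR m.+1 * s ^ m.+1) (- ln (1 - s)).
Proof.
move=> hs.
(* A zero constant coefficient makes this a genuine power series; it is removed again by
   [is_series_incr_1]. *)
pose a (k : nat) : R := if k is 0%N then 0 else / INR k.
have Sgt0 k : 0 < INR k.+1 by apply: lt_0_INR; lia.
have acv t : Rabs t < 1 -> Rbar_lt (Rabs t) (CV_radius a).
  apply: (@lt_CV_radius a 1 1 t) => [|k]; first lra.
  rewrite pow1 Rmult_1_r; case: k => [|k] /=; first by rewrite Rabs_R0; lra.
  have := Sgt0 k; rewrite -/(INR k.+1) => h.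
  rewrite Rabs_pos_eq; last exact/Rlt_le/Rinv_0_lt_compat.
  rewrite -[X in _ <= X]Rinv_1; apply: Rinv_le_contravar; first lra.
  by rewrite S_INR; have := pos_INR k; lra.
have da t : Rabs t < 1 -> is_derive (fun t => PSeries a t + ln (1 - t)) t 0.
  move=> ht; have /Rabs_lt_between ht' := ht.
  have -> : 0 = plus (/ (1 - t)) (scal (-1) (/ (1 - t))) by rewrite /plus /scal /= /mult /=; ring.
  apply: (is_derive_plus (K := R_AbsRing)).
    have := is_derive_PSeries a t (acv t ht).
    have -> : PSeries (PS_derive a) t = / (1 - t) => //.
    apply: is_series_unique; apply: is_series_ext (is_series_geom t ht) => k.
    by rewrite /PS_derive /a Rinv_r ?Rmult_1_l //; have := Sgt0 k; lra.
  apply: (is_derive_comp (K := R_AbsRing) ln (fun t => 1 - t)).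
    by apply/is_derive_Reals/derivable_pt_lim_ln; lra.
  rewrite -[X in is_derive _ _ X]/(- (1)).
  have -> : -(1) = Hierarchy.minus (Hierarchy.zero : R_NormedModule) Hierarchy.one by rewrite /Hierarchy.minus /Hierarchy.plus /Hierarchy.zero /Hierarchy.opp /Hierarchy.one /=; ring.
  apply: (is_derive_minus (K := R_AbsRing)); [exact: is_derive_const|exact: is_derive_id].
have e0 : PSeries a 0 + ln (1 - 0) = 0.
  by rewrite PSeries_0 Rminus_0_r ln_1 /a; ring.
have e : PSeries a s + ln (1 - s) = 0.
  have /Rabs_lt_between hs' := hs.
  have [h|[h|h]] := Rtotal_order s 0.
  - rewrite -[RHS]e0; apply: (eq_is_derive (V := R_NormedModule) (fun t => PSeries a t + ln (1 - t)) s 0) => // t ht.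
    by apply: da; apply/Rabs_lt_between; lra.
  - by rewrite h.
  - rewrite -[RHS]e0; apply/esym; apply: (eq_is_derive (V := R_NormedModule) (fun t => PSeries a t + ln (1 - t)) 0 s) => // t ht.
    by apply: da; apply/Rabs_lt_between; lra.
have h : is_series (fun k => a k * s ^ k) (PSeries a s).
  by apply: Series_correct; apply: ex_series_Rabs; apply: CV_disk_inside; apply: acv.
have := is_series_incr_1 (K := R_AbsRing) (V := R_NormedModule) (fun k => a k * s ^ k) (PSeries a s).
have -> : - ln (1 - s) = PSeries a s by lra.
apply; have -> : Hierarchy.plus (PSeries a s) (a 0%N * s ^ 0) = PSeries a s => //.
by rewrite /Hierarchy.plus /=; ring.
Qed.

Section PowerSeries.
Variable n : nat.
Local Notation E := (Mx n).
Implicit Types (a b : nat -> E) (A : E) (B : R).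

(** Coefficients of the power of exponent [m.+1]; the shift is that of the series of
    [- log (1 - z)], whose coefficients in time are [log_coef]. *)
Fixpoint cpow a m : nat -> E := if m is m'.+1 then conv a (cpow a m') else a.
Definition log_coef a k : E := msum (fun m => rsc (/ INR m.+1) (cpow a m k)).
(* Symmetrizing the coefficients makes the solution Hermitian by construction, so that it need
   not be shown that a power series commutes with its Cauchy powers. *)
Definition herm A : E := rsc (/ 2) (A + adj A).

Lemma adj_herm A : adj (herm A) = herm A.
Proof. by rewrite /herm adjZ adjD adjK addrC. Qed.
Lemma herm_id A : adj A = A -> herm A = A.
Proof.
by move=> h; apply: coord_inj => b i j; rewrite /herm h coord_scal coord_add; field.
Qed.
Lemma opn_herm A : opn (herm A) <= opn A.
Proof.
rewrite /herm; apply: Rle_trans (opnZ _ _) _; rewrite Rabs_pos_eq; last lra.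
by have := opn_add A (adj A); have := opn_adj A; lra.
Qed.

Lemma conv_local a a' b b' k : (forall j, (j <= k)%N -> a j = a' j) ->
  (forall j, (j <= k)%N -> b j = b' j) -> conv a b k = conv a' b' k.
Proof.
move=> ha hb; apply: eq_bigr => j _.
by rewrite ha ?hb ?leq_subr // -ltnS.
Qed.
Lemma cpow_local a a' k : (forall j, (j <= k)%N -> a j = a' j) ->
  forall m j, (j <= k)%N -> cpow a m j = cpow a' m j.
Proof.
move=> h; elim=> [|m IH] j jk /=; first exact: h.
by apply: conv_local => i ij; [apply: h|apply: IH]; apply: leq_trans jk.
Qed.
(** Only the coefficients up to [k] enter, so a recursion that defines the coefficient [k.+1] from
    [log_coef a k] is well founded. *)
Lemma log_coef_local a a' k : (forall j, (j <= k)%N -> a j = a' j) ->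
  log_coef a k = log_coef a' k.
Proof. by move=> h; apply: msum_ext => m; rewrite (cpow_local h). Qed.

Variable r : R.
Hypothesis r0 : 0 < r.

(** The weighted norm is bounded through its partial sums, so a bound can be stated before any
    convergence is known. *)
Definition wbd a (B : R) := forall K, rsum (fun k => opn (a k) * r ^ k) K <= B.

Lemma wterm_ge0 a k : 0 <= opn (a k) * r ^ k.
Proof. by apply: Rmult_le_pos (opn_ge0 _) _; apply: pow_le; lra. Qed.
Lemma wsum_shift a K : rsum (fun k => opn (a k) * r ^ k) K.+1 =
  opn (a 0%N) + rsum (fun k => opn (a k.+1) * r ^ k.+1) K.
Proof. by rewrite rsum_shift; congr (_ + _); exact: Rmult_1_r. Qed.
Lemma wbd_ge0 a B : wbd a B -> 0 <= B.
Proof. by move/(_ 0%N). Qed.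
Lemma wbd_term a B k : wbd a B -> opn (a k) * r ^ k <= B.
Proof.
move=> h; apply: Rle_trans (h k.+1).
by apply: (rsum_term (x := fun k => opn (a k) * r ^ k)) => // j; apply: wterm_ge0.
Qed.
Lemma wbd_le a b B : (forall k, opn (a k) <= opn (b k)) -> wbd b B -> wbd a B.
Proof.
move=> h hb K; apply: Rle_trans (hb K); apply: rsum_le => k.
by apply: Rmult_le_compat_r; [apply: pow_le; lra|].
Qed.
Lemma wbd_weaken a B B' : B <= B' -> wbd a B -> wbd a B'.
Proof. by move=> h hb K; apply: Rle_trans (hb K) h. Qed.
Lemma wbdZ c a B : wbd a B -> wbd (fun k => rsc c (a k)) (Rabs c * B).
Proof.
move=> h K; apply: (Rle_trans _ (rsum (fun k => Rabs c * (opn (a k) * r ^ k)) K)).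
  apply: rsum_le => k; rewrite -Rmult_assoc; apply: Rmult_le_compat_r; last exact: opnZ.
  by apply: pow_le; lra.
by rewrite rsum_scal; apply: Rmult_le_compat_l (Rabs_pos _) (h K).
Qed.
Lemma wbd_conv a b (A B : R) : wbd a A -> wbd b B -> wbd (conv a b) (A * B).
Proof.
move=> ha hb K; pose x k := opn (a k) * r ^ k; pose y k := opn (b k) * r ^ k.
apply: (Rle_trans _ (rsum (rconv x y) K)).
  apply: rsum_le => k.
  have -> : rconv x y k = rconv (fun k => opn (a k)) (fun k => opn (b k)) k * r ^ k.
    rewrite Rmult_comm /rconv scal_sum; apply: PartSum.sum_eq => j jk.
    have -> : r ^ k = r ^ j * r ^ (k - j) by rewrite -pow_add plusE subnKC //; apply/ssrnat.leP.
    by rewrite /x /y; ring.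
  by apply: Rmult_le_compat_r; [apply: pow_le; lra|exact: opn_conv].
apply: Rle_trans (rsum_rconv_le _ _ _) _; [exact: wterm_ge0|exact: wterm_ge0|].
apply: Rmult_le_compat (ha K) (hb K); apply: rsum_ge0; exact: wterm_ge0.
Qed.
Lemma wbd_cpow a q m : wbd a q -> wbd (cpow a m) (q ^ m.+1).
Proof.
move=> h; elim: m => [|m IH]; first by rewrite pow_1.
exact: wbd_conv.
Qed.
Lemma wbd_psum (g : nat -> nat -> E) (beta : nat -> R) L : (forall m, wbd (g m) (beta m)) ->
  wbd (fun k => psum (fun m => g m k) L) (rsum beta L).
Proof.
move=> h K; elim: L => [|L IH] /=.
  suff -> : rsum (fun k => opn (0%R : E) * r ^ k) K = 0 by lra.
  by elim: K => [//|K IH] /=; rewrite IH opn0; ring.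
apply: (Rle_trans _ (rsum (fun k => opn (psum (fun m => g m k) L) * r ^ k) K
   + rsum (fun k => opn (g L k) * r ^ k) K)); last by have := h L K; lra.
elim: K {IH} => [|K IH] /=; first lra.
have hr : 0 <= r ^ K by apply: pow_le; lra.
have := Rmult_le_compat_r _ _ _ hr (opn_add (psum (fun m => g m K) L) (g L K)).
lra.
Qed.
(** A partial sum involves finitely many coefficients, so a uniform bound survives coefficientwise
    limits. *)
Lemma wbd_lim (u : nat -> nat -> E) a B : (forall k, mlim (fun L => u L k) (a k)) ->
  (forall L, wbd (u L) B) -> wbd a B.
Proof.
move=> hu hB K.
have h : is_lim_seq (fun L => rsum (fun k => opn (u L k) * r ^ k) K)
    (rsum (fun k => opn (a k) * r ^ k) K).
  elim: K => [|K IH] /=; first exact: is_lim_seq_const.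
  apply: is_lim_seq_plus' => //; apply: is_lim_seq_mult'; first exact: mlim_opn.
  exact: is_lim_seq_const.
exact: (is_lim_seq_le _ (fun=> B) (rsum _ K) B (fun L => hB L K) h (is_lim_seq_const _)).
Qed.

Lemma psum_cat (f : nat -> E) L d :
  psum f (L + d)%N = (psum f L + psum (fun m => f (L + m)%N) d)%R.
Proof. by elim: d => [|d IH]; rewrite ?addn0 ?addr0 // addnS /= IH addrA. Qed.

Lemma Rabs_inv_INR m : Rabs (/ INR m.+1) <= 1.
Proof.
have h := pos_INR m; rewrite S_INR Rabs_pos_eq; last by apply/Rlt_le/Rinv_0_lt_compat; lra.
rewrite -[X in _ <= X]Rinv_1; apply: Rinv_le_contravar; lra.
Qed.

Section LogCoef.
Variables (a : nat -> E) (q : R).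
Hypotheses (ha : wbd a q) (hq : q < 1).
Let q0 : 0 <= q := wbd_ge0 ha.
Let g m k : E := rsc (/ INR m.+1) (cpow a m k).

Let wbd_g m : wbd (g m) (q * q ^ m).
Proof.
have := wbdZ (/ INR m.+1) (wbd_cpow m ha); apply: wbd_weaken.
have := Rmult_le_compat_r _ _ _ (pow_le q m.+1 q0) (Rabs_inv_INR m); rewrite /=; lra.
Qed.

Lemma mser_log_coef k : mser (fun m => g m k) (log_coef a k).
Proof.
have rk : 0 < r ^ k by apply: pow_lt.
apply: (mser_msum (x := fun m => q / r ^ k * fro (1%:M : E) * q ^ m)) => [m|].
  apply: Rle_trans (fro_le_opn _) _.
  have h : opn (g m k) <= q / r ^ k * q ^ m.
    have := wbd_term k (wbd_g m) => h.
    apply: (Rmult_le_reg_r _ _ _ rk).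
    have -> : q / r ^ k * q ^ m * r ^ k = q * q ^ m by field; lra.
    exact: h.
  have := Rmult_le_compat_r _ _ _ (fro_ge0 (1%:M : E)) h; rewrite /g; lra.
apply: ex_series_scal_l; apply: ex_series_geom; rewrite Rabs_pos_eq //.
Qed.

(** Truncating the logarithm after [L] powers costs a geometric tail in the weighted norm. The
    estimate controls all coefficients at once, which later permits exchanging the sum over powers
    with the sum over time exponents. *)
Lemma wbd_log_coef_tail L :
  wbd (fun k => log_coef a k - psum (fun m => g m k) L)%R (q * q ^ L / (1 - q)).
Proof.
apply: (wbd_lim (u := fun d k => psum (fun m => g (L + m)%N k) d)) => [k|d].
  have h : mlim (fun d => psum (fun m => g m k) (L + d)%N) (log_coef a k).
    have := mser_log_coef k; rewrite /mser /mlim (is_lim_seq_incr_n _ L) => h.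
    by apply: is_lim_seq_ext h => d; rewrite addnC.
  apply: mlim_ext (mlimB h (mlim_const (psum (fun m => g m k) L))) => d.
  by rewrite psum_cat addrC addKr.
have := wbd_psum d (fun m => wbd_g (L + m)%N); apply: wbd_weaken.
have -> : rsum (fun m => q * q ^ (L + m)) d = q * q ^ L * rsum (fun m => q ^ m) d.
  rewrite -rsum_scal; elim: d => [//|d IH] /=; rewrite IH pow_add; ring.
apply: Rmult_le_compat_l; first by apply: Rmult_le_pos => //; apply: pow_le.
by apply: rsum_geom.
Qed.

Lemma wbd_log_coef : wbd (log_coef a) (/ (1 - q)).
Proof.
apply: (wbd_weaken (B := q * q ^ 0 / (1 - q))); last first.
  by apply: wbd_le (wbd_log_coef_tail 0) => k /=; rewrite subr0; exact: Rle_refl.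
rewrite /= Rmult_1_r -[X in _ <= X]Rmult_1_l.
by apply: Rmult_le_compat_r; [apply/Rlt_le/Rinv_0_lt_compat|]; lra.
Qed.
End LogCoef.

Definition sc a (s : R) k : E := rsc (s ^ k) (a k).

Section Eval.
Variable s : R.
Hypothesis hs : Rabs s <= r.

Lemma opn_sc a k : opn (sc a s k) <= opn (a k) * r ^ k.
Proof.
apply: Rle_trans (opnZ _ _) _; rewrite -RPow_abs Rmult_comm.
apply: Rmult_le_compat_l (opn_ge0 _) _; apply: pow_incr; split=> //; exact: Rabs_pos.
Qed.
Lemma rsum_opn_sc a B N : wbd a B -> rsum (fun k => opn (sc a s k)) N <= B.
Proof. by move=> h; apply: Rle_trans (h N); apply: rsum_le => k; apply: opn_sc. Qed.
Lemma ex_series_sc a B : wbd a B -> ex_series (fun k => fro (sc a s k)).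
Proof.
move=> h; apply: (ex_series_bounded (B := fro (1%:M : E) * B)) => [k|N]; first exact: fro_ge0.
apply: (Rle_trans _ (rsum (fun k => fro (1%:M : E) * opn (sc a s k)) N)).
  by apply: rsum_le => k; rewrite Rmult_comm; apply: fro_le_opn.
by rewrite rsum_scal; apply: Rmult_le_compat_l (fro_ge0 _) _; apply: rsum_opn_sc.
Qed.
Lemma mser_sc a B : wbd a B -> mser (sc a s) (msum (sc a s)).
Proof. by move=> h; apply: mser_msum (ex_series_sc h) => k; apply: Rle_refl. Qed.
Lemma opn_mser_sc a B S : wbd a B -> mser (sc a s) S -> opn S <= B.
Proof. by move=> h hS; apply: mser_opn_le hS _ => N; apply: rsum_opn_sc. Qed.
Lemma conv_sc a b k : conv (sc a s) (sc b s) k = sc (conv a b) s k.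
Proof.
rewrite /sc /conv rsc_sum; apply: eq_bigr => j _.
rewrite rscAl rscAr rscA; congr (HermitianMatrices.rsc _ _).
by rewrite -[LHS]pow_add plusE subnKC // -ltnS.
Qed.
Lemma mser_cpow a q (S : E) m : wbd a q -> mser (sc a s) S -> mser (sc (cpow a m) s) (S ^+ m.+1)%R.
Proof.
move=> h hS; elim: m => [|m IH]; first by rewrite expr1.
apply: (mser_ext (f := conv (sc a s) (sc (cpow a m) s))) => [k|]; first exact: conv_sc.
by rewrite exprS; apply: mser_conv => //; apply: ex_series_sc; [exact: h|exact: wbd_cpow h].
Qed.

(** For each truncation at [L] powers the two sums exchange, being a finite combination of Cauchy
    powers; the error of the truncation is the weighted tail, which tends to zero with [q ^ L]. *)
Lemma mser_log a q S : wbd a q -> q < 1 -> mser (sc a s) S ->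
  mser (fun m => rsc (/ INR m.+1) (S ^+ m.+1)%R) (msum (sc (log_coef a) s)).
Proof.
move=> h hq hS; have q0 := wbd_ge0 h.
pose P L := psum (fun m => rsc (/ INR m.+1) (S ^+ m.+1)%R) L.
pose b L k := psum (fun m => rsc (/ INR m.+1) (cpow a m k)) L.
have hP L : mser (sc (b L) s) (P L).
  elim: L => [|L IH].
    apply: (mlim_ext (u := fun=> 0%R)); last exact: mlim_const.
    elim=> [//|N IH] /=; rewrite -IH /sc /b /= /HermitianMatrices.rsc scaler0 addr0; done.
  apply: mser_ext (mserD IH (mserZ (/ INR L.+1) (mser_cpow L h hS))) => k.
  by rewrite /sc /b /= rscDr !rscA; congr (_ + HermitianMatrices.rsc _ _)%R; exact: Rmult_comm.
have hB := mser_sc (wbd_log_coef h hq).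
apply: (mlim_le (phi := fun L => q / (1 - q) * fro (1%:M : E) * q ^ L)) => [L|].
  rewrite fro_sym; apply: Rle_trans (fro_le_opn _) _.
  have hD : mser (sc (fun k => log_coef a k - b L k)%R s) (msum (sc (log_coef a) s) - P L)%R.
    rewrite -rscN1; apply: mser_ext (mserD hB (mserZ (-1) (hP L))) => k.
    by rewrite /sc rscN1 -rscBr.
  have := Rmult_le_compat_r _ _ _ (fro_ge0 (1%:M : E)) (opn_mser_sc (wbd_log_coef_tail h hq L) hD).
  by rewrite /P /Rdiv; lra.
have h0 : is_lim_seq (fun L => q ^ L) 0 by apply: is_lim_seq_geom; rewrite Rabs_pos_eq.
have := is_lim_seq_scal_l _ (q / (1 - q) * fro (1%:M : E)) 0 h0.
by rewrite /= Rmult_0_r.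
Qed.
End Eval.

Lemma is_derive_msum_sc a B (b : bool) i j s D : wbd a B -> Rabs s < r ->
  mser (sc (fun k => rsc (INR k.+1) (a k.+1)) s) D ->
  is_derive (fun s => coord b i j (msum (sc a s))) s (coord b i j D).
Proof.
move=> h hs hD; pose c k := coord b i j (a k).
have e t : coord b i j (msum (sc a t)) = PSeries c t.
  rewrite coord_of_coords; apply: Series_ext => k.
  by rewrite coord_scal Rmult_comm.
apply: (is_derive_ext (PSeries c)); first by move=> t; rewrite e.
have -> : coord b i j D = PSeries (PS_derive c) s.
  apply/esym/is_series_unique; have := @mser_coord _ _ _ b i j hD; apply: is_series_ext => k.
  rewrite !coord_scal /PS_derive /c.
  by rewrite -[LHS]/(s ^ k * (INR k.+1 * coord b i j (a k.+1)))%coqR -[RHS]/(INR k.+1 * coord b i j (a k.+1) * s ^ k)%coqR Rmult_comm.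
apply: is_derive_PSeries; apply: (lt_CV_radius (r := r) (B := fro (1%:M : E) * B)) => //; first lra.
move=> k; apply: (Rle_trans _ (fro (1%:M : E) * (opn (a k) * r ^ k))).
  rewrite -Rmult_assoc; apply: Rmult_le_compat_r; first by apply: pow_le; lra.
  by rewrite Rmult_comm; apply: Rle_trans (coord_le_fro _ _ _ _) (fro_le_opn _).
by apply: Rmult_le_compat_l (fro_ge0 _) _; apply: wbd_term.
Qed.
End PowerSeries.

(** * The local analytic solution *)

Lemma fro_sp_le n (U : Mx n) (l : 'I_n -> R) (B : R) : unitary U ->
  (forall i, Rabs (l i) <= B) -> 0 <= B -> fro (sp U l) <= B * fro (1%:M : Mx n).
Proof.
move=> uU h B0; apply: Rle_trans (fro_le_opn _) _.
by apply: Rmult_le_compat_r (fro_ge0 _) _; apply: opn_sp.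
Qed.

Lemma mser_log_sp n (U : Mx n) (l : 'I_n -> R) : unitary U -> (forall i, Rabs (l i) < 1) ->
  mser (fun m => rsc (/ INR m.+1) ((sp U l) ^+ m.+1)%R) (sp U (fun i => - ln (1 - l i))).
Proof.
move=> uU hl; pose f L i := rsum (fun m => / INR m.+1 * l i ^ m.+1) L.
have e L : psum (fun m => rsc (/ INR m.+1) ((sp U l) ^+ m.+1)%R) L = sp U (f L).
  elim: L => [|L IH] /=; first by rewrite (sp_const 0 uU) rsc0.
  by rewrite IH spX // spZ spD; apply: eq_sp => i; rewrite /f /= -RpowE.
pose d L i : Rf := Rabs (f L i - - ln (1 - l i)).
pose D L := (\sum_i d L i)%R.
apply: (mlim_le (phi := fun L => D L * fro (1%:M : Mx n))) => [L|].
  rewrite e spB; apply: fro_sp_le => // [i|].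
    apply/RleP; rewrite /D (bigD1 i) //= lerDl; apply: sumr_ge0 => j _.
    exact/RleP/Rabs_pos.
  by apply/RleP; apply: sumr_ge0 => j _; exact/RleP/Rabs_pos.
have : is_lim_seq D (\sum_(i < n) (0 : Rf))%R.
  apply: is_lim_seq_bigsum => i; rewrite /d.
  have /is_series_rsum h := log_series (hl i).
  have := is_lim_seq_abs _ _ (is_lim_seq_minus' _ _ _ _ h (is_lim_seq_const (- ln (1 - l i)))).
  by rewrite /= Rminus_diag Rabs_R0.
rewrite big1 // => hD.
have := is_lim_seq_scal_r _ (fro (1%:M : Mx n)) 0 hD.
by rewrite /= Rmult_0_l.
Qed.

Lemma mser_single n (f : nat -> Mx n) : (forall k, f k.+1 = 0%R) -> mser f (f 0%N).
Proof.
move=> h; apply/mlim_incr; apply: (mlim_ext (u := fun=> f 0%N)); last exact: mlim_const.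
elim=> [|N IH]; first by rewrite /= add0r.
by rewrite -[RHS]/(psum f N.+1 + f N.+1)%R h addr0.
Qed.

Section FlowCoef.
Variables (n : nat) (x y z0 : Mx n) (M rho q r : R).
Hypotheses (M0 : 0 < M) (hrho : opn z0 <= rho) (hrq : rho <= q) (hq : q < 1) (r0 : 0 < r).
(** The self-map condition: the initial value uses up [rho] of the radius [q], and the integrated
    right-hand side must fit into the rest. *)
Hypothesis hr : r * (kap x y / M) * / (1 - q) <= q - rho.
Local Notation E := (Mx n).
Implicit Types a : nat -> E.

(* The [k]-th coefficient of an iterate of [flow_step] is stationary from the [k]-th iterate on. *)
Definition flow_step a k : E :=
  if k is k'.+1 then rsc (- / (M * INR k'.+1)) (lapm x y (herm (log_coef a k'))) else z0.
Fixpoint flow_iter N : nat -> E :=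
  if N is N'.+1 then flow_step (flow_iter N') else fun k => if k is 0%N then z0 else 0%R.
Definition flow_coef k := flow_iter k k.

Lemma flow_step_local a a' k : (forall j, (j <= k)%N -> a j = a' j) ->
  flow_step a k.+1 = flow_step a' k.+1.
Proof. by move=> h; rewrite /= (log_coef_local h). Qed.
Lemma flow_iter_stable N k : (k <= N)%N -> flow_iter N.+1 k = flow_iter N k.
Proof.
elim: N k => [|N IH] k kN; first by move: kN; rewrite leqn0 => /eqP ->.
case: k kN => [|k] kN; first by [].
apply: flow_step_local => j jk; apply: IH; exact: leq_trans jk kN.
Qed.
Lemma flow_coef_iter N k : (k <= N)%N -> flow_coef k = flow_iter N k.
Proof.
move=> kN; rewrite -(subnKC kN); elim: (N - k)%N => [|d IH]; first by rewrite addn0.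
by rewrite addnS flow_iter_stable ?leq_addr.
Qed.
Lemma flow_coef_rec k : flow_coef k = flow_step flow_coef k.
Proof.
case: k => [|k]; first by [].
rewrite [LHS]/flow_coef -[flow_iter k.+1 k.+1]/(flow_step (flow_iter k) k.+1).
by apply: flow_step_local => j jk; rewrite (flow_coef_iter jk).
Qed.

(** Shifting the index by one gains a factor [r], the integration factor [/ INR k.+1] is at most 1,
    and the logarithm of a series in the ball is bounded by [/ (1 - q)]. *)
Lemma wbd_flow_step a : wbd r a q -> wbd r (flow_step a) q.
Proof.
move=> ha [|K]; first exact: wbd_ge0 ha.
rewrite wsum_shift.
have hk := kap_ge0 x y.
have kM : 0 <= kap x y / M by apply: Rdiv_le_0_compat.
apply: (Rle_trans _ (rho + rsum (fun k => r * (kap x y / M) * (opn (log_coef a k) * r ^ k)) K)).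
  apply: Rplus_le_compat; [exact: hrho|apply: rsum_le => k].
  have rk : 0 <= r ^ k by apply: pow_le; lra.
  have h : opn (flow_step a k.+1) <= kap x y / M * opn (log_coef a k).
    apply: Rle_trans (opnZ _ _) _; rewrite Rabs_Ropp Rinv_mult Rabs_mult.
    rewrite (Rabs_pos_eq (/ M)); last exact/Rlt_le/Rinv_0_lt_compat.
    have h1 := Rabs_inv_INR k; have h2 := opn_lapm x y (herm (log_coef a k)).
    have h3 := Rmult_le_compat_l _ _ _ hk (opn_herm (log_coef a k)).
    have h4 := opn_ge0 (lapm x y (herm (log_coef a k))).
    have iM : 0 < / M by apply: Rinv_0_lt_compat.
    have -> : kap x y / M * opn (log_coef a k) = / M * 1 * (kap x y * opn (log_coef a k)) by rewrite /Rdiv; ring.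
    apply: Rmult_le_compat; [|exact: h4| |exact: Rle_trans h2 h3].
      by apply: Rmult_le_pos; [lra|exact: Rabs_pos].
    by apply: Rmult_le_compat_l; lra.
  have h5 : 0 <= r * r ^ k by apply: Rmult_le_pos => //; lra.
  have := Rmult_le_compat_r _ _ _ h5 h; rewrite [r ^ k.+1]/=; lra.
rewrite rsum_scal.
have h6 : 0 <= r * (kap x y / M) by apply: Rmult_le_pos; lra.
have := Rmult_le_compat_l _ _ _ h6 (wbd_log_coef r0 ha hq K); lra.
Qed.

Lemma wbd_flow_coef : wbd r flow_coef q.
Proof.
have h N : wbd r (flow_iter N) q.
  elim: N => [|N IH]; last exact: wbd_flow_step.
  have z00 := opn_ge0 z0.
  case=> [|K]; first by rewrite /=; lra.
  rewrite wsum_shift.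
  suff -> : rsum (fun k => opn (flow_iter 0 k.+1) * r ^ k.+1) K = 0 by rewrite [flow_iter _ _]/=; lra.
  by elim: K => [//|K' IHK] /=; rewrite IHK opn0; ring.
(* A partial sum of length [K] sees only coefficients that have become stationary by iterate [K]. *)
move=> K; rewrite (eq_rsum (y := fun k => opn (flow_iter K k) * r ^ k)); first exact: (h K K).
by move=> k kK; rewrite (flow_coef_iter (ltnW kK)).
Qed.

Lemma flow_coef_exists : exists a, [/\ a 0%N = z0,
  forall k, a k.+1 = rsc (- / (M * INR k.+1)) (lapm x y (herm (log_coef a k))) & wbd r a q].
Proof.
exists flow_coef; split; [by []| |exact: wbd_flow_coef].
by move=> k; rewrite flow_coef_rec.
Qed.
End FlowCoef.

Section LocalFlow.
Variables (n : nat) (x y : Mx n) (M q r : R) (a : nat -> Mx n).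
Hypotheses (hx : adj x = x) (hy : adj y = y) (hz0 : adj (a 0%N) = a 0%N).
Hypotheses (M0 : 0 < M) (hq : q < 1) (r0 : 0 < r) (wa : wbd r a q).
Hypothesis haS : forall k, a k.+1 = rsc (- / (M * INR k.+1)) (lapm x y (herm (log_coef a k))).

Lemma adj_flow_coef k : adj (a k) = a k.
Proof.
case: k => [|k]; first exact: hz0.
by rewrite haS adjZ (adj_lapm _ hx hy) adj_herm.
Qed.

Definition flow_val s := msum (sc a s).

Section At.
Variable s : R.
Hypothesis hs : Rabs s <= r.

Lemma mser_flow_val : mser (sc a s) (flow_val s).
Proof. exact: (mser_sc hs wa). Qed.
Lemma opn_flow_val : opn (flow_val s) <= q.
Proof. exact: (opn_mser_sc hs wa mser_flow_val). Qed.
Lemma adj_flow_val : adj (flow_val s) = flow_val s.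
Proof.
apply: mlim_unique (mser_flow_val); have := mser_adj mser_flow_val; apply: mser_ext => k.
by rewrite /sc adjZ adj_flow_coef.
Qed.

Lemma flow_val_spectral : exists U l, [/\ unitary U, flow_val s = sp U l,
  forall i, Rabs (l i) <= q &
  msum (sc (log_coef a) s) = sp U (fun i => - ln (1 - l i))].
Proof.
have [U [l [uU e]]] := hermitian_spectral adj_flow_val.
have hl i : Rabs (l i) <= q.
  by apply: Rle_trans opn_flow_val; rewrite e; apply: sp_le_opn.
exists U, l; split; [exact: uU|exact: e|exact: hl|].
apply: mlim_unique (mser_log r0 hs wa hq mser_flow_val) _.
by rewrite e; apply: mser_log_sp => // i; have := hl i; lra.
Qed.

(** The symmetrized recursion still produces the flow: the logarithm series sums to a function of a
    Hermitian matrix, which [herm] leaves fixed. *)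
Lemma is_derive_flow_val b i j U l : Rabs s < r -> unitary U -> flow_val s = sp U l ->
  msum (sc (log_coef a) s) = sp U (fun i => - ln (1 - l i)) ->
  is_derive (fun t => coord b i j (flow_val t)) s
    (coord b i j (rsc (/ M) (lapm x y (sp U (fun i => ln (1 - l i)))))).
Proof.
move=> hs' uU e eB.
apply: (is_derive_msum_sc (B := q) r0 b i j wa hs').
have hB := mser_sc hs (wbd_log_coef r0 wa hq).
have hH : mser (fun k => rsc (- / M) (lapm x y (rsc (/ 2) (sc (log_coef a) s k + adj (sc (log_coef a) s k))%R)))
   (rsc (- / M) (lapm x y (herm (msum (sc (log_coef a) s))))).
  exact/mserZ/mser_lapm/mserZ/mserD/mser_adj.
have -> : rsc (/ M) (lapm x y (sp U (fun i => ln (1 - l i)))) =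
   rsc (- / M) (lapm x y (herm (msum (sc (log_coef a) s)))).
  rewrite eB (herm_id (adj_sp U _)).
  have -> : sp U (fun i => - ln (1 - l i)) = rsc (-1) (sp U (fun i => ln (1 - l i))).
    by rewrite rscN1 spN.
  rewrite lapmZ rsc_rsc; apply: eq_rsc; ring.
apply: mser_ext hH => k; rewrite /sc haS /herm.
have -> : rsc (s ^ k) (rsc (INR k.+1) (rsc (- / (M * INR k.+1))
   (lapm x y (rsc (/ 2) (log_coef a k + adj (log_coef a k))%R)))) =
  rsc (- / M) (rsc (s ^ k) (lapm x y (rsc (/ 2) (log_coef a k + adj (log_coef a k))%R))).
  rewrite !rsc_rsc; apply: eq_rsc.
  have k0 : INR k.+1 <> 0 by apply: not_0_INR.
  by field; split => //; lra.
rewrite adjZ -rscDr -[X in _ = rsc _ X]lapmZ !(rsc_rsc _ _ (_ + _)).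
by do 2 apply: f_equal; apply: eq_rsc; ring.
Qed.
End At.
End LocalFlow.

Lemma local_flow n (x y : Mx n) (e M : R) : adj x = x -> adj y = y -> 0 < e <= M ->
  exists r e', 0 < r /\ 0 < e' /\ forall U l, unitary U -> (forall i, e <= l i <= M) ->
    exists (a : nat -> Mx n) (c : R -> Mx n), c 0 = sp U l /\ forall s, Rabs s <= r ->
      mser (sc a s) (c s) /\ exists V m, [/\ unitary V, c s = sp V m, forall i, e' <= m i &
        Rabs s < r -> forall b i j, is_derive (fun t => coord b i j (c t)) s
           (coord b i j (- lapm x y (sp V (fun i => ln (m i))))%R)].
Proof.
move=> hx hy [e0 eM].
have M0 : 0 < M by lra.
(* [rho] bounds the norm of [1 - c / M] when the spectrum of [c] lies in [[e, M]]; [q] is halfway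
   between [rho] and 1. *)
pose rho := 1 - e / M; pose q := (1 + rho) / 2.
have eM1 : 0 < e / M <= 1.
  split; first exact: Rdiv_lt_0_compat.
  by apply/Rle_div_l => //; lra.
have hk := kap_ge0 x y.
have hq : q < 1 by rewrite /q /rho; lra.
have hqr : rho < q by rewrite /q /rho; lra.
(* Chosen to satisfy the self-map condition; the [+ 1] keeps the denominator positive when [kap x y]
   vanishes. *)
pose r := (q - rho) * (1 - q) * M / (kap x y + 1).
have r0 : 0 < r.
  by apply: Rdiv_lt_0_compat; [do ?[apply: Rmult_lt_0_compat]|]; lra.
have hr : r * (kap x y / M) * / (1 - q) <= q - rho.
  have -> : r * (kap x y / M) * / (1 - q) = (q - rho) * (kap x y / (kap x y + 1)).
    by rewrite /r; field; lra.
  rewrite -[X in _ <= X]Rmult_1_r; apply: Rmult_le_compat_l; first lra.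
  by apply/Rle_div_l; lra.
(* The second witness equals [e / 2]: the eigenvalues [M * (1 - m i)] stay above it because each
   [m i] is at most [q]. *)
exists r, (M * (1 - q)); split => //; split; first by apply: Rmult_lt_0_compat; lra.
move=> U l uU hl.
pose z0 := sp U (fun i => 1 - l i / M).
have hz0 : adj z0 = z0 by rewrite adj_sp.
have hrho : opn z0 <= rho.
  apply: opn_sp => //; first by rewrite /rho; lra.
  move=> i; have [h1 h2] := hl i.
  have : e / M <= l i / M by apply: Rmult_le_compat_r => //; apply/Rlt_le/Rinv_0_lt_compat.
  have : l i / M <= 1 by apply/Rle_div_l; lra.
  by move=> h3 h4; rewrite Rabs_pos_eq /rho; lra.
have hrq : rho <= q by lra.
have [a [ha0 haS wa]] := flow_coef_exists M0 hrho hrq hq r0 hr.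
pose z := flow_val a.
have hz0' : adj (a 0%N) = a 0%N by rewrite ha0.
pose one0 k : Mx n := if k is 0%N then 1%:M%R else 0%R.
have hone s : mser (sc one0 s) 1%:M%R.
  have -> : (1%:M%R : Mx n) = sc one0 s 0 by rewrite /sc /= rsc1.
  by apply: mser_single => k; rewrite /sc /HermitianMatrices.rsc scaler0.
have hz s : Rabs s <= r -> mser (sc (a) s) (z s).
  by move=> h; exact: (mser_flow_val wa h).
exists (fun k => rsc M (one0 k - a k)%R), (fun s => rsc M (1%:M - z s)%R).
split.
  have -> : z 0 = z0.
    have := hz 0; rewrite Rabs_R0 => /(_ (Rlt_le _ _ r0)) h; apply: mlim_unique h _.
    have -> : z0 = sc a 0 0 by rewrite /sc /= rsc1.
    by apply: mser_single => k; rewrite /sc /= Rmult_0_l rsc0.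
  rewrite /z0 -(rsc1 1%:M%R) -(sp_const 1 uU) spB spZ; apply: eq_sp => i.
  have el : (M * (1 - (1 - l i / M)))%coqR = l i by field; lra.
  exact: el.
move=> s hs; split.
  rewrite -rscN1; apply: mser_ext (mserZ M (mserD (hone s) (mserZ (-1) (hz s hs)))) => k.
  by rewrite /sc rscN1 -rscBr !rsc_rsc; apply: eq_rsc; ring.
have [V [m [uV ez hm eB]]] := flow_val_spectral hx hy hz0' hq r0 wa haS hs.
have hm1 i : 0 < 1 - q <= 1 - m i by have /Rabs_le_between := hm i; lra.
exists V, (fun i => M * (1 - m i)); split; [exact: uV| | |].
- by rewrite -/z in ez; rewrite ez -(rsc1 1%:M%R) -(sp_const 1 uV) spB spZ.
- by move=> i; apply: Rmult_le_compat_l; have := hm1 i; lra.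
move=> hs' b i j.
have hd := is_derive_flow_val M0 hq r0 wa haS hs b i j hs' uV ez eB.
(* Rescaling by [M] adds the scalar matrix [ln M] to the logarithm, and the Laplacian annihilates
   it. *)
have -> : coord b i j (- lapm x y (sp V (fun i => ln (M * (1 - m i)))))%R =
   (- M) * coord b i j (rsc (/ M) (lapm x y (sp V (fun i => ln (1 - m i))))).
  have -> : sp V (fun i => ln (M * (1 - m i))) = (rsc (ln M) 1%:M + sp V (fun i => ln (1 - m i)))%R.
    by rewrite -(sp_const _ uV) spD; apply: eq_sp => k; rewrite ln_mult //; have := hm1 k; lra.
  by rewrite lapmD lapmZ lapm1 coord_opp coord_add !coord_scal coord0; field; lra.
have hd2 := is_derive_scal (fun t => coord b i j (z t)) s (- M) _ hd.
have hd3 := is_derive_plus (K := R_AbsRing) (V := R_NormedModule) _ _ _ _ _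
   (is_derive_const (K := R_AbsRing) (V := R_NormedModule) (M * coord b i j 1%:M%R) s) hd2.
rewrite Hierarchy.plus_zero_l in hd3; apply: is_derive_ext hd3 => t.
have et : M * coord b i j 1%:M%R + - M * coord b i j (z t) =
  M * (coord b i j 1%:M%R - coord b i j (z t)) by ring.
by rewrite coord_scal coord_sub; exact: et.
Qed.

(** * Differentiation of matrix curves *)

Notation derw := Defs.is_deriv_within.
Notation contw := Defs.cont_within.

Lemma derw_D_in I f t l : derw I f t l <-> D_in f (fun=> l) I t.
Proof.
split=> h eps e0; have [d [d0 hd]] := h eps e0; exists d; split=> // s.
  by move=> [[Is st] sd]; apply: hd => //; apply: not_eq_sym.
by move=> Is st sd; apply: hd; split => //; split => //; apply: not_eq_sym.
Qed.
Lemma derw_mul I f g t l m : derw I f t l -> derw I g t m ->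
  derw I (fun s => f s * g s) t (l * g t + f t * m).
Proof.
move=> /derw_D_in hf /derw_D_in hg; apply/derw_D_in.
exact: (Dmult I (fun=> l) (fun=> m) f g t hf hg).
Qed.
Lemma is_derive_derw I (f : R -> R) t l T : is_derive f (t - T) l -> derw I (fun s => f (s - T)) t l.
Proof.
move=> /is_derive_Reals h eps e0; have [d hd] := h eps e0.
exists d; split=> [|s _ st sd]; first exact: cond_pos.
have := hd (s - t); have -> : t - T + (s - t) = s - T by ring.
by apply => //; lra.
Qed.
Lemma derw_contw I f t l : derw I f t l -> contw I f t.
Proof.
move=> h eps e0; have [d [d0 hd]] := h 1 Rlt_0_1.
have hl := Rabs_pos l.
exists (Rmin d (eps / (Rabs l + 1))); split.
  by apply: Rmin_pos => //; apply: Rdiv_lt_0_compat; lra.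
move=> s Is sd.
have [->|st] := Req_dec s t; first by rewrite Rminus_diag Rabs_R0.
have h1 : Rabs (s - t) < d by apply: Rlt_le_trans sd (Rmin_l _ _).
have h2 : Rabs (s - t) * (Rabs l + 1) < eps.
  by apply/Rlt_div_r; [lra|apply: Rlt_le_trans sd (Rmin_r _ _)].
have h3 := hd s Is st h1.
have st0 : s - t <> 0 by lra.
have -> : f s - f t = (s - t) * ((f s - f t) / (s - t) - l + l) by field.
rewrite Rabs_mult; apply: Rle_lt_trans h2; apply: Rmult_le_compat_l; first exact: Rabs_pos.
by apply: Rle_trans (Rabs_triang _ _) _; lra.
Qed.

(* Composing with the retraction of the line onto [a, b] turns one-sided derivatives at the
   end points into two-sided continuity, as required by the mean value theorem. *)
Lemma MVT_within (f l : R -> R) a b : a < b ->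
  (forall t, a <= t <= b -> derw (fun s => a <= s <= b) f t (l t)) ->
  exists c, a <= c <= b /\ f b - f a = l c * (b - a).
Proof.
move=> ab hf; pose k t := Rmax a (Rmin b t).
have kab t : a <= k t <= b.
  by rewrite /k /Rmax /Rmin; case: (Rle_dec b t); case: (Rle_dec a _); lra.
have kid t : a <= t <= b -> k t = t.
  by rewrite /k /Rmax /Rmin; case: (Rle_dec b t); case: (Rle_dec a _); lra.
have klip s t : a <= t <= b -> Rabs (k s - t) <= Rabs (s - t).
  move=> ht; have := Rle_abs (s - t); have := Rle_abs (- (s - t)); rewrite Rabs_Ropp => h1 h2.
  apply: Rabs_le; rewrite /k /Rmax /Rmin.
  by case: (Rle_dec b s) => ?; case: (Rle_dec a _) => ?; lra.
have [||c [hc e]] := MVT_gen (fun t => f (k t)) a b l.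
- rewrite Rmin_left ?Rmax_right; try lra; move=> t ht.
  apply/is_derive_Reals => eps e0.
  have ht' : a <= t <= b by lra.
  have [d [d0 hd]] := hf t ht' eps e0.
  have d1 : 0 < Rmin d (Rmin (t - a) (b - t)) by do ?[apply: Rmin_pos]; lra.
  exists (mkposreal _ d1) => h h0 /= hh.
  have := Rmin_l d (Rmin (t - a) (b - t)); have := Rmin_r d (Rmin (t - a) (b - t)).
  have := Rmin_l (t - a) (b - t); have := Rmin_r (t - a) (b - t) => h1 h2 h3 h4.
  have /Rabs_lt_between hh' := hh.
  rewrite !kid; try lra.
  have := hd (t + h); have -> : t + h - t = h by ring.
  by apply; lra.
- rewrite Rmin_left ?Rmax_right; try lra; move=> t ht eps e0.
  have [d [d0 hd]] := derw_contw (hf t ht) e0.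
  exists d; split => // s [_ sd].
  have sd' : Rabs (s - t) < d by exact: sd.
  have h := hd (k s) (kab s) (Rle_lt_trans _ _ _ (klip s t ht) sd').
  by rewrite -{1}(kid t ht) in h; exact: h.
rewrite Rmin_left ?Rmax_right in hc; try lra.
by exists c; split => //; rewrite !kid in e; lra.
Qed.

Lemma derw_nonincreasing (f : R -> R) a b : a <= b ->
  (forall t, a <= t <= b -> exists l, derw (fun s => a <= s <= b) f t l /\ l <= 0) ->
  f b <= f a.
Proof.
move=> ab hf; have [h|->] : a < b \/ a = b by lra.
  (* Derivatives are given pointwise only; choice makes them the function required by the mean value
     theorem. *)
  pose P t l := derw (fun s => a <= s <= b) f t l /\ l <= 0.
  have hP t : a <= t <= b -> P t (epsilon (inhabits 0) (P t)).
    by move=> ht; apply: epsilon_spec; apply: hf.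
  have [c [hc e]] := MVT_within h (fun t ht => proj1 (hP t ht)).
  by have [_ h1] := hP c hc; nra.
lra.
Qed.

Section Dynamics.
Variable n : nat.
Local Notation E := (Mx n).
Implicit Types (I J : R -> Prop) (c d : R -> E) (D G : E).

(** First-order expansion in norm, written without a quotient so that [s = t] needs no exception. *)
Definition mder I c t D := forall eps, 0 < eps -> exists delta, 0 < delta /\
  forall s, I s -> Rabs (s - t) < delta ->
    fro (c s - c t - rsc (s - t) D)%R <= eps * Rabs (s - t).

Lemma mder_sub I J c t D : (forall s, J s -> I s) -> mder I c t D -> mder J c t D.
Proof.
move=> JI h eps e0; have [d [d0 hd]] := h eps e0; exists d; split=> // s /JI; exact: hd.
Qed.
Lemma mder_coord I c t D b i j : mder I c t D -> derw I (fun s => coord b i j (c s)) t (coord b i j D).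
Proof.
move=> h eps e0; have e2 : 0 < eps / 2 by lra.
have [d [d0 hd]] := h _ e2; exists d; split=> // s Is st sd.
have st0 : s - t <> 0 by lra.
have h1 := Rle_trans _ _ _ (coord_le_fro b i j _) (hd s Is sd).
rewrite !coord_sub coord_scal in h1.
have -> : (coord b i j (c s) - coord b i j (c t)) / (s - t) - coord b i j D =
   (coord b i j (c s) - coord b i j (c t) - (s - t) * coord b i j D) / (s - t) by field.
rewrite Rabs_div //; apply: (Rle_lt_trans _ (eps / 2)); last lra.
by apply/Rle_div_l => //; apply: Rabs_pos_lt.
Qed.

Let small I t (g : R -> R) := forall eps, 0 < eps -> exists delta, 0 < delta /\
  forall s, I s -> Rabs (s - t) < delta -> g s <= eps * Rabs (s - t).

Let small_sum I t (T : Type) (r : seq T) (g : T -> R -> Rf) : (forall k, small I t (g k)) ->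
  small I t (fun s => \sum_(k <- r) g k s)%R.
Proof.
move=> h; elim: r => [|k r IH] eps e0.
  exists 1; split; first lra; move=> s _ _; rewrite big_nil.
  by apply: Rmult_le_pos; [lra|apply: Rabs_pos].
have e2 : 0 < eps / 2 by lra.
have [d [d0 hd]] := h k _ e2; have [d' [d'0 hd']] := IH _ e2.
exists (Rmin d d'); split; first exact: Rmin_pos.
move=> s Is sd; rewrite big_cons.
have h1 := hd s Is (Rlt_le_trans _ _ _ sd (Rmin_l _ _)).
have h2 := hd' s Is (Rlt_le_trans _ _ _ sd (Rmin_r _ _)).
have -> : eps * Rabs (s - t) = eps / 2 * Rabs (s - t) + eps / 2 * Rabs (s - t) by field.
exact: Rplus_le_compat.
Qed.

Lemma mder_coords I c t D :
  (forall b i j, derw I (fun s => coord b i j (c s)) t (coord b i j D)) -> mder I c t D.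
Proof.
move=> h; pose X s := (c s - c t - rsc (s - t) D)%R.
have hX b i j : small I t (fun s => Rabs (coord b i j (X s))).
  move=> eps e0; have [d [d0 hd]] := h b i j eps e0; exists d; split=> // s Is sd.
  rewrite /X !coord_sub coord_scal.
  have [->|st] := Req_dec s t.
    by rewrite !Rminus_diag Rmult_0_l Rminus_diag Rabs_R0; lra.
  have st0 : s - t <> 0 by lra.
  have := hd s Is st sd.
  have -> : coord b i j (c s) - coord b i j (c t) - (s - t) * coord b i j D =
     ((coord b i j (c s) - coord b i j (c t)) / (s - t) - coord b i j D) * (s - t) by field.
  move=> h1; rewrite Rabs_mult; apply: Rmult_le_compat_r; [exact: Rabs_pos|lra].
pose g s := (\sum_(b : bool) \sum_(i < n) \sum_(j < n) (Rabs (coord b i j (X s)) : Rf))%R.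
have hg : small I t g.
  by apply: small_sum => b; apply: small_sum => i; apply: small_sum => j; apply: hX.
have Xg s : fro (X s) <= 2 * INR n * g s.
  apply: fro_le_coords => b i j; apply/RleP; rewrite /g.
  rewrite (bigD1 b) //= (bigD1 i) //= (bigD1 j) //= -!addrA lerDl.
  by rewrite !addr_ge0 //; do ?[apply: sumr_ge0 => ? _]; apply/RleP/Rabs_pos.
move=> eps e0; have n0 := pos_INR n.
have e1 : 0 < eps / (2 * INR n + 1) by apply: Rdiv_lt_0_compat; lra.
have [d [d0 hd]] := hg _ e1; exists d; split => // s Is sd.
apply: Rle_trans (Xg s) _.
have h1 := hd s Is sd; have h2 := Rabs_pos (s - t).
have h3 : 2 * INR n * g s <= 2 * INR n * (eps / (2 * INR n + 1) * Rabs (s - t)).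
  by apply: Rmult_le_compat_l => //; lra.
apply: Rle_trans h3 _.
have -> : 2 * INR n * (eps / (2 * INR n + 1) * Rabs (s - t)) =
   (2 * INR n / (2 * INR n + 1)) * (eps * Rabs (s - t)) by field; lra.
rewrite -[X in _ <= X]Rmult_1_l; apply: Rmult_le_compat_r; first by apply: Rmult_le_pos; lra.
by apply/Rle_div_l; lra.
Qed.

Lemma mderB I c d t D G : mder I c t D -> mder I d t G ->
  mder I (fun s => c s - d s)%R t (D - G)%R.
Proof.
move=> hc hd eps e0; have e2 : 0 < eps / 2 by lra.
have [a [a0 ha]] := hc _ e2; have [b [b0 hb]] := hd _ e2.
exists (Rmin a b); split; first exact: Rmin_pos.
move=> s Is sd.
have h1 := ha s Is (Rlt_le_trans _ _ _ sd (Rmin_l _ _)).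
have h2 := hb s Is (Rlt_le_trans _ _ _ sd (Rmin_r _ _)).
have -> : (c s - d s - (c t - d t) - rsc (s - t) (D - G) =
  (c s - c t - rsc (s - t) D) - (d s - d t - rsc (s - t) G))%R.
  by apply: coord_inj => b' i j; rewrite !(coord_sub, coord_scal); ring.
by apply: Rle_trans (fro_sub _ _) _; lra.
Qed.

Lemma mder_lipschitz I c t D : mder I c t D -> exists delta, 0 < delta /\
  forall s, I s -> Rabs (s - t) < delta -> fro (c s - c t)%R <= (fro D + 1) * Rabs (s - t).
Proof.
move=> h; have [a [a0 ha]] := h 1 Rlt_0_1; exists a; split => // s Is sd.
have h1 := ha s Is sd; have := fro_add (c s - c t - rsc (s - t) D)%R (rsc (s - t) D).
by rewrite subrK froZ; lra.
Qed.

(** A chain rule for a functional with gradient [G] and quadratic error: the curve is Lipschitz at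
    [t], so this error is of order [(s - t) ^ 2]. *)
Lemma derw_functional I c t D (psi : R -> R) G K : mder I c t D ->
  (forall s, I s -> Rabs (psi s - psi t - ip G (c s - c t)) <= K * (fro (c s - c t)%R * fro (c s - c t)%R)) ->
  derw I psi t (ip G D).
Proof.
move=> hc hpsi eps e0.
pose K' := Rabs K; have K0 : 0 <= K' := Rabs_pos K.
have g0 := fro_ge0 G; have d0 := fro_ge0 D.
have e1 : 0 < eps / (2 * (fro G + 1)) by apply: Rdiv_lt_0_compat; lra.
have [a [a0 ha]] := hc _ e1; have [b [b0 hb]] := mder_lipschitz hc.
pose L := K' * ((fro D + 1) * (fro D + 1)) + 1.
have L0 : 0 < L by rewrite /L; have := Rmult_le_pos _ _ K0 (Rlt_le _ _ (Rmult_lt_0_compat (fro D + 1) (fro D + 1) ltac:(lra) ltac:(lra))); lra.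
exists (Rmin (Rmin a b) (eps / (2 * L))); split.
  by do ?[apply: Rmin_pos] => //; apply: Rdiv_lt_0_compat; lra.
move=> s Is st sd.
have sab : Rabs (s - t) < Rmin a b by apply: Rlt_le_trans sd (Rmin_l _ _).
have h1 := ha s Is (Rlt_le_trans _ _ _ sab (Rmin_l _ _)).
have h2 := hb s Is (Rlt_le_trans _ _ _ sab (Rmin_r _ _)).
have h3 : Rabs (s - t) < eps / (2 * L) by apply: Rlt_le_trans sd (Rmin_r _ _).
have h4 := hpsi s Is.
have st0 : s - t <> 0 by lra.
have p0 : 0 < Rabs (s - t) by apply: Rabs_pos_lt.
have -> : (psi s - psi t) / (s - t) - ip G D =
   (psi s - psi t - ip G (c s - c t) + ip G (c s - c t - rsc (s - t) D)%R) / (s - t).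
  by rewrite (ip_subr (c s - c t)%R) ip_scalr; field.
rewrite Rabs_div //; apply/Rlt_div_l => //.
apply: Rle_lt_trans (Rabs_triang _ _) _.
have h5 := Rle_trans _ _ _ (ip_cauchy_schwarz G _) (Rmult_le_compat_l _ _ _ g0 h1).
have f0 := fro_ge0 (c s - c t)%R.
have h6 : K * (fro (c s - c t)%R * fro (c s - c t)%R) <= L * Rabs (s - t) * Rabs (s - t).
  apply: (Rle_trans _ (K' * (fro (c s - c t)%R * fro (c s - c t)%R))).
    by apply: Rmult_le_compat_r; [nra|exact: Rle_abs].
  have h7 := Rmult_le_compat _ _ _ _ f0 f0 h2 h2.
  have := Rmult_le_compat_l _ _ _ K0 h7; rewrite /L; nra.
have h8 : L * Rabs (s - t) < eps / 2.
  have := Rmult_lt_compat_l _ _ _ L0 h3.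
  by have -> : L * (eps / (2 * L)) = eps / 2 by field; lra.
have h9 : fro G * (eps / (2 * (fro G + 1))) < eps / 2.
  have -> : fro G * (eps / (2 * (fro G + 1))) = fro G / (fro G + 1) * (eps / 2) by field; lra.
  rewrite -[X in _ < X]Rmult_1_l; apply: Rmult_lt_compat_r; first lra.
  by apply/Rlt_div_l; lra.
have := Rmult_lt_compat_r _ _ _ p0 h8; have := Rmult_lt_compat_r _ _ _ p0 h9.
lra.
Qed.

Lemma ln_lip e s t : 0 < e -> e <= s -> e <= t -> Rabs (ln s - ln t) <= / e * Rabs (s - t).
Proof.
move=> e0.
have key u v : e <= u -> e <= v -> ln u - ln v <= / e * Rabs (u - v).
  move=> hu hv.
  have h : ln u - ln v <= u / v - 1.
    rewrite -ln_div; try lra.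
    have := exp_ineq1_le (ln (u / v)); rewrite exp_ln; first lra.
    by apply: Rdiv_lt_0_compat; lra.
  apply: Rle_trans h _.
  have -> : u / v - 1 = / v * (u - v) by field; lra.
  apply: (Rle_trans _ (/ v * Rabs (u - v))).
    by apply: Rmult_le_compat_l; [apply/Rlt_le/Rinv_0_lt_compat; lra|exact: Rle_abs].
  by apply: Rmult_le_compat_r; [exact: Rabs_pos|apply: Rinv_le_contravar].
move=> hs ht; apply/Rabs_le_between.
by have := key s t hs ht; have := key t s ht hs; rewrite (Rabs_minus_sym t s); lra.
Qed.

Lemma sp_ln_lip (U V : E) l m e : unitary U -> unitary V -> 0 < e ->
  (forall i, e <= l i) -> (forall i, e <= m i) ->
  fro (sp U (fun i => ln (l i)) - sp V (fun i => ln (m i))) <= / e * fro (sp U l - sp V m).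
Proof.
move=> uU uV e0 hl hm.
have ie : 0 < / e by apply: Rinv_0_lt_compat.
apply: fro_le; first by apply: Rmult_le_pos (fro_ge0 _); lra.
have -> : / e * fro (sp U l - sp V m) * (/ e * fro (sp U l - sp V m)) =
   / e * / e * ip (sp U l - sp V m) (sp U l - sp V m) by rewrite -fro_sqr; ring.
apply/RleP; apply: (ip_sp_lip (L := (/ e * / e)%coqR)) => // i j; apply/RleP.
rewrite -[X in X <= _]/((ln (l i) - ln (m j)) * (ln (l i) - ln (m j))).
rewrite -[X in _ <= X]/(/ e * / e * ((l i - m j) * (l i - m j))).
have h := ln_lip e0 (hl i) (hm j).
have := Rmult_le_compat _ _ _ _ (Rabs_pos _) (Rabs_pos _) h h.
rewrite -Rabs_mult (Rabs_pos_eq ((_ - _) * _)); last exact: Rle_0_sqr.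
have -> : / e * Rabs (l i - m j) * (/ e * Rabs (l i - m j)) =
   / e * / e * Rabs ((l i - m j) * (l i - m j)) by rewrite Rabs_mult; ring.
by rewrite (Rabs_pos_eq ((l i - m j) * _)) //; exact: Rle_0_sqr.
Qed.

Lemma finite_positive_bound (l : 'I_n -> R) : (forall i, 0 < l i) ->
  exists e M, 0 < e <= M /\ forall i, e <= l i <= M.
Proof.
move=> h; have : forall s : seq 'I_n, exists e M, 0 < e <= M /\ forall i, i \in s -> e <= l i <= M.
  (* The bounds [1, 1] start the induction and settle dimension 0, where positive bounds are still
     required. *)
  elim=> [|i s [e [M [[e0 eM] hs]]]]; first by exists 1, 1; split => //; lra.
  exists (Rmin e (l i)), (Rmax M (l i)); split.
    split; first by apply: Rmin_pos.
    by apply: Rle_trans (Rmin_l _ _) (Rle_trans _ _ _ eM (Rmax_l _ _)).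
  move=> j; rewrite inE => /orP[/eqP->|/hs [h1 h2]].
    by split; [apply: Rmin_r|apply: Rmax_r].
  by split; [apply: Rle_trans (Rmin_l _ _) h1|apply: Rle_trans h2 (Rmax_l _ _)].
move=> /(_ (enum 'I_n)) [e [M [h1 h2]]]; exists e, M; split => // i.
by apply: h2; rewrite mem_enum.
Qed.

(** The logarithm does not depend on the diagonalization: this is the Lipschitz bound at distance
    zero. *)
Lemma sp_ln_eq (U V : E) l m : unitary U -> unitary V -> (forall i, 0 < l i) ->
  (forall i, 0 < m i) -> sp U l = sp V m ->
  sp U (fun i => ln (l i)) = sp V (fun i => ln (m i)).
Proof.
move=> uU uV hl hm e.
have [a [M [[a0 _] ha]]] := finite_positive_bound hl.
have [b [M' [[b0 _] hb]]] := finite_positive_bound hm.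
have h0 : 0 < Rmin a b by apply: Rmin_pos.
have h1 i : Rmin a b <= l i by apply: Rle_trans (Rmin_l _ _) _; case: (ha i).
have h2 i : Rmin a b <= m i by apply: Rle_trans (Rmin_r _ _) _; case: (hb i).
have := sp_ln_lip uU uV h0 h1 h2; rewrite e subrr fro0 Rmult_0_r => h.
apply/eqP; rewrite -subr_eq0; apply/eqP/fro_eq0.
exact: Rle_antisym h (fro_ge0 _).
Qed.

(** Having eigenvalues in [[e, M]] means lying in an operator-norm ball around the midpoint times
    the identity, and the norm does not see the basis. *)
Lemma spectrum_bounds (U V : E) l m e M : unitary U -> unitary V ->
  sp U l = sp V m -> (forall i, e <= l i <= M) -> forall i, e <= m i <= M.
Proof.
move=> uU uV eq hl i.
have h j : Rabs (l j - (e + M) / 2) <= (M - e) / 2.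
  by apply/Rabs_le_between; have := hl j; lra.
have h0 : 0 <= (M - e) / 2 by have := hl i; lra.
have := opn_sp uU h0 h.
have -> : sp U (fun j => l j - (e + M) / 2) = sp V (fun j => m j - (e + M) / 2).
  have := spB U l (fun=> (e + M) / 2); have := spB V m (fun=> (e + M) / 2).
  by rewrite !sp_const // eq => <- <-.
move=> h1; have := Rle_trans _ _ _ (sp_le_opn (fun j => m j - (e + M) / 2) i uV) h1.
by move=> /Rabs_le_between; lra.
Qed.
End Dynamics.

(** * Maximum principle and uniqueness *)

(** For [e <= M], the signed distance to [[e, M]]: the subtracted term is the nearest point of the
    interval. *)
Definition excess (e M s : R) := s - Rmax e (Rmin M s).

Lemma excess_quadratic e M s t : e <= M ->
  0 <= excess e M t * excess e M t - excess e M s * excess e M s - 2 * excess e M s * (t - s)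
    <= (t - s) * (t - s).
Proof.
move=> eM; rewrite /excess.
(* The variational inequality of the projection onto a convex set; used in both orders it gives both
   bounds. *)
have key u v : (u - Rmax e (Rmin M u)) * (Rmax e (Rmin M v) - Rmax e (Rmin M u)) <= 0.
  rewrite /Rmax /Rmin.
  by case: (Rle_dec M u) => ?; case: (Rle_dec M v) => ?; do ?[case: (Rle_dec e _) => ?]; nra.
have := key s t; have := key t s.
move: (Rmax e (Rmin M s)) (Rmax e (Rmin M t)) => p p' h1 h2.
have := Rle_0_sqr ((t - p') - (s - p)); have := Rle_0_sqr (p' - p); rewrite /Rsqr => h3 h4.
by split; lra.
Qed.
Lemma excess_ln_mono e M s t : e <= M -> 0 < s -> 0 < t ->
  0 <= (ln s - ln t) * (2 * excess e M s - 2 * excess e M t).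
Proof.
move=> eM; wlog st : s t / s <= t => [hw s0 t0|s0 t0].
  have [st|ts] := Rle_lt_dec s t; first exact: hw.
  have := hw t s (Rlt_le _ _ ts) t0 s0; lra.
have h1 : ln s <= ln t by apply: ln_le.
have h2 : excess e M s <= excess e M t.
  by rewrite /excess /Rmax /Rmin; case: (Rle_dec M s) => ?; case: (Rle_dec M t) => ?;
    do ?[case: (Rle_dec e _) => ?]; lra.
nra.
Qed.
Lemma excess_eq0 e M s : excess e M s = 0 <-> e <= s <= Rmax e M.
Proof.
by rewrite /excess /Rmax /Rmin; case: (Rle_dec M s) => ?; case: (Rle_dec e M) => ?;
  do ?[case: (Rle_dec e _) => ?]; split; lra.
Qed.

Section Flow.
Variables (n : nat) (x y : Mx n).
Hypotheses (hx : adj x = x) (hy : adj y = y).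
Local Notation E := (Mx n).
Implicit Types (I J : R -> Prop) (c d f : R -> E) (A U V : E) (l m : 'I_n -> R).

Definition vfield U l : E := (- lapm x y (sp U (fun i => ln (l i))))%R.
(** The eigenbasis is existential at each time, with no coherence between times; by [sol_at] the
    derivative does not depend on it. *)
Definition sol I c := forall t, I t -> exists U l,
  [/\ unitary U, c t = sp U l, forall i, 0 < l i & mder I c t (vfield U l)].
Definition spec_in A (e M : R) := exists U l, [/\ unitary U, A = sp U l & forall i, e <= l i <= M].
Definition spec_ge A (e : R) := exists U l, [/\ unitary U, A = sp U l & forall i, e <= l i].

Lemma spec_in_ge A e M : spec_in A e M -> spec_ge A e.
Proof. by move=> [U [l [uU eA h]]]; exists U, l; split=> // i; case: (h i). Qed.
Lemma spec_ge_le A e e' : e' <= e -> spec_ge A e -> spec_ge A e'.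
Proof. by move=> ee [U [l [uU eA h]]]; exists U, l; split=> // i; have := h i; lra. Qed.

Lemma sol_sub I J c : (forall s, J s -> I s) -> sol I c -> sol J c.
Proof.
move=> JI h t /[dup] Jt /JI It; have [U [l [uU e l0 hd]]] := h t It.
by exists U, l; split=> //; apply: mder_sub hd.
Qed.
Lemma sol_at I c t U l : sol I c -> I t -> unitary U -> c t = sp U l -> (forall i, 0 < l i) ->
  mder I c t (vfield U l).
Proof.
move=> h It uU e l0; have [V [m [uV e' m0 hd]]] := h t It.
suff <- : vfield V m = vfield U l by [].
by rewrite /vfield (sp_ln_eq uV uU m0 l0) // -e -e'.
Qed.

Definition diagonalization A : E * ('I_n -> R) :=
  epsilon (inhabits (0%R : E, fun=> 0)) (fun p => unitary p.1 /\ A = sp p.1 p.2).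
Lemma diagonalizationP A U l : unitary U -> A = sp U l ->
  unitary (diagonalization A).1 /\ A = sp (diagonalization A).1 (diagonalization A).2.
Proof.
move=> uU e; rewrite /diagonalization.
by apply: (epsilon_spec _ (fun p : E * ('I_n -> R) => unitary p.1 /\ A = sp p.1 p.2)); exists (U, l).
Qed.

Lemma ip_vfield_le0 e M U l : e <= M -> unitary U -> (forall i, 0 < l i) ->
  ip (sp U (fun i => 2 * excess e M (l i))) (vfield U l) <= 0.
Proof.
move=> eM uU l0.
have h z : adj z = z -> 0 <= ip (sp U (fun i => 2 * excess e M (l i)))
     (com z (com z (sp U (fun i => ln (l i))))).
  move=> hz; apply/RleP; rewrite ip_com_sp //; apply: sumr_ge0 => i _; apply: sumr_ge0 => j _.
  apply: mulr_ge0; first exact: normsq_ge0.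
  by apply/RleP; apply: excess_ln_mono.
rewrite /vfield ip_oppr /HermitianMatrices.lapm ip_addr.
by have := h x hx; have := h y hy; lra.
Qed.

(* Maximum principle: [tr (dist (c, [e, M])^2)] is nonincreasing along the flow. *)
Lemma spectrum_invariant I c a b e M : a <= b -> (forall t, a <= t <= b -> I t) -> sol I c ->
  e <= M -> spec_in (c a) e M -> spec_in (c b) e M.
Proof.
move=> ab hI hc eM [U0 [l0 [uU0 e0 hl0]]].
have hc' : sol (fun t => a <= t <= b) c by apply: sol_sub hc.
pose U t := (diagonalization (c t)).1; pose l t := (diagonalization (c t)).2.
have hUl t : a <= t <= b -> [/\ unitary (U t), c t = sp (U t) (l t), forall i, 0 < l t i
   & mder (fun t => a <= t <= b) c t (vfield (U t) (l t))].
  move=> ht; have [V [m [uV eV m0 hd]]] := hc' t ht.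
  have [uU eU] := diagonalizationP uV eV.
  have [e1 [M1 [[e10 _] hb]]] := finite_positive_bound m0.
  have lpos i : 0 < l t i.
    have [h _] := spectrum_bounds uV uU (etrans (esym eV) eU) hb i.
    exact: Rlt_le_trans e10 h.
  split; [exact: uU|exact: eU|exact: lpos|exact: (sol_at hc' ht uU eU lpos)].
pose G s : Rf := excess e M s * excess e M s.
pose g s : Rf := 2 * excess e M s.
have hG (s t : Rf) : (0 <= G t - G s - g s * (t - s) <= (t - s) ^+ 2)%R.
  by have [h1 h2] := excess_quadratic s t eM; apply/andP; split; apply/RleP.
pose psi t : R := (\sum_i G (l t i))%R.
have hpsi : psi b <= psi a.
  apply: derw_nonincreasing => // t ht; have [uU eU lpos hd] := hUl t ht.
  exists (ip (sp (U t) (fun i => 2 * excess e M (l t i))) (vfield (U t) (l t))).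
  split; last exact: ip_vfield_le0.
  (* Although the chosen eigenbases may jump, [psi] is differentiable because [trace_fun_quadratic]
     compares two arbitrary ones. *)
  apply: (derw_functional (K := 1) hd) => s hs; have [uU' eU' _ _] := hUl s hs.
  have /andP[/RleP h1 /RleP h2] := trace_fun_quadratic (l t) (l s) (G := G) (g := g) uU uU'
     hG.
  rewrite -eU -eU' in h1 h2.
  have h3 := fro_sqr (c s - c t)%R.
  rewrite Rmult_1_l h3; apply/Rabs_le_between; split; last exact: h2.
  apply: (Rle_trans _ 0); last exact: h1.
  by have := ip_nonneg (c s - c t)%R; lra.
have haa : a <= a <= b by lra.
have hbb : a <= b <= b by lra.
have eqM : Rmax e M = M by apply: Rmax_right.
have psia : psi a = 0.
  rewrite /psi big1 // => i _; have [uU eU _ _] := hUl a haa.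
  have hi := spectrum_bounds uU0 uU (etrans (esym e0) eU) hl0 i.
  suff h0 : excess e M (l a i) = 0 by rewrite /G h0 Rmult_0_l.
  by apply/excess_eq0; rewrite eqM.
have [uU eU _ _] := hUl b hbb; exists (U b), (l b); split => // i.
have Gge0 j : (0 <= G (l b j))%R by apply/RleP; apply: Rle_0_sqr.
have h : G (l b i) <= 0.
  rewrite -psia; apply: Rle_trans hpsi; apply/RleP; rewrite /psi (bigD1 i) //= lerDl.
  exact: sumr_ge0.
rewrite -[X in _ <= _ <= X]eqM; apply/excess_eq0; rewrite /G in h; nra.
Qed.

Lemma derw_dist2 I c d t D G : mder I c t D -> mder I d t G ->
  derw I (fun s => ip (c s - d s) (c s - d s)) t (ip (rsc 2 (c t - d t)) (D - G)).
Proof.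
move=> hc hd; apply: (derw_functional (K := 1) (mderB hc hd)) => s _.
rewrite Rmult_1_l fro_sqr; set A := (c s - d s)%R; set B := (c t - d t)%R.
clearbody A B.
have -> : ip A A - ip B B - ip (rsc 2 B) (A - B) = ip (A - B) (A - B).
  by rewrite ip_scall !ip_subl !ip_subr (ipC B A); ring.
by rewrite Rabs_pos_eq; [lra|exact: ip_nonneg].
Qed.

(* Both [exp (- K t) |c - d|^2] and [- exp (K t) |c - d|^2] are nonincreasing, which gives
   uniqueness forwards and backwards in time. *)
Lemma sol_eq_iff I c d a b e : a <= b -> (forall t, a <= t <= b -> I t) -> sol I c -> sol I d ->
  0 < e -> (forall t, a <= t <= b -> spec_ge (c t) e /\ spec_ge (d t) e) ->
  (c a = d a <-> c b = d b).
Proof.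
move=> ab hI hc hd e0 hs.
pose w t : R := ip (c t - d t) (c t - d t).
(* The factor 2 comes from differentiating the square; [kap x y / e] is the Lipschitz constant of
   the flow on spectra above [e]. *)
pose K := 2 * (kap x y / e).
have hw t : a <= t <= b -> exists l : R, derw (fun t => a <= t <= b) w t l /\ Rabs l <= K * w t.
  move=> ht; have [[U [l [uU eU hl]]] [V [m [uV eV hm]]]] := hs t ht.
  have l0 i : 0 < l i by have := hl i; lra.
  have m0 i : 0 < m i by have := hm i; lra.
  have h1 := mder_sub hI (sol_at hc (hI t ht) uU eU l0).
  have h2 := mder_sub hI (sol_at hd (hI t ht) uV eV m0).
  exists (ip (rsc 2 (c t - d t)) (vfield U l - vfield V m)); split; first exact: derw_dist2.
  rewrite ip_scall Rabs_mult (Rabs_pos_eq 2); last lra.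
  have h3 := ip_cauchy_schwarz (c t - d t)%R (vfield U l - vfield V m)%R.
  have h4 : fro (vfield U l - vfield V m)%R <= kap x y * (/ e * fro (c t - d t)%R).
    rewrite /vfield -opprD froN -lapmN -lapmD; apply: Rle_trans (fro_lapm _ _ _) _.
    apply: Rmult_le_compat_l (kap_ge0 _ _) _; rewrite eU eV; exact: sp_ln_lip.
  have h5 := Rmult_le_compat_l _ _ _ (fro_ge0 (c t - d t)%R) h4.
  rewrite /w -fro_sqr /K /Rdiv; lra.
have hexp k t : derw (fun t => a <= t <= b) (fun t => exp (k * t)) t (k * exp (k * t)).
  have h : is_derive (fun t => exp (k * t)) (t - 0) (k * exp (k * t)).
    rewrite Rminus_0_r; apply/is_derive_Reals.
    have -> : k * exp (k * t) = exp (k * t) * k by ring.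
    apply: (derivable_pt_lim_comp (fun t => k * t) exp t k); last exact: derivable_pt_lim_exp.
    by have := derivable_pt_lim_scal id k t 1 (derivable_pt_lim_id t); rewrite Rmult_1_r.
  have := is_derive_derw (fun t => a <= t <= b) h.
  move=> h' eps eps0; have [dl [dl0 hdl]] := h' eps eps0; exists dl; split=> // s Is st sd.
  by have := hdl s Is st sd; rewrite !Rminus_0_r.
have w0 t : 0 <= w t by apply: ip_nonneg.
have eq0 t : w t = 0 -> c t = d t.
  by move=> h; apply/eqP; rewrite -subr_eq0; apply/eqP; apply: ip_eq0.
have w_eq t : c t = d t -> w t = 0.
  by move=> h; rewrite /w h subrr -fro_sqr fro0 Rmult_0_l.
have fwd : exp (- K * b) * w b <= exp (- K * a) * w a.
  apply: (derw_nonincreasing (f := fun t => exp (- K * t) * w t)) => // t ht.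
  have [l [hl /Rabs_le_between hb]] := hw t ht.
  exists (- K * exp (- K * t) * w t + exp (- K * t) * l); split; first exact: derw_mul.
  have := exp_pos (- K * t); nra.
have bwd : - exp (K * b) * w b <= - exp (K * a) * w a.
  rewrite !Ropp_mult_distr_l_reverse !Ropp_mult_distr_r.
  apply: (derw_nonincreasing (f := fun t => exp (K * t) * - w t)) => // t ht.
  have [l [hl /Rabs_le_between hb]] := hw t ht.
  have hml : derw (fun t => a <= t <= b) (fun t => - w t) t (- l).
    move=> eps eps0; have [dl [dl0 hdl]] := hl eps eps0; exists dl; split=> // s Is st sd.
    have := hdl s Is st sd; rewrite -Rabs_Ropp.
    have -> // : - ((w s - w t) / (s - t) - l) = (- w s - - w t) / (s - t) - - l by field; lra.
  exists (K * exp (K * t) * - w t + exp (K * t) * - l); split; first exact: derw_mul.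
  have := exp_pos (K * t); nra.
split=> /w_eq h; apply: eq0; rewrite h in fwd bwd.
  by have := exp_pos (- K * b); have := w0 b; nra.
by have := exp_pos (K * a); have := w0 a; nra.
Qed.
End Flow.

(** * Global existence and analyticity *)

Section Existence.
Variables (n : nat) (x y : Mx n).
Hypotheses (hx : adj x = x) (hy : adj y = y).
Local Notation E := (Mx n).
Local Notation sol := (sol x y).
Local Notation vfield := (vfield x y).
Implicit Types (I J : R -> Prop) (c d f D : R -> E) (A U V : E) (l m : 'I_n -> R).

Lemma mder_local I J c f t (D : E) : (exists delta, 0 < delta /\
    forall s, I s -> Rabs (s - t) < delta -> J s /\ f s = c s) -> f t = c t ->
  mder J c t D -> mder I f t D.
Proof.
move=> [a [a0 ha]] e h eps e0; have [b [b0 hb]] := h eps e0.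
exists (Rmin a b); split; first exact: Rmin_pos.
move=> s Is sd; have [Js ->] := ha s Is (Rlt_le_trans _ _ _ sd (Rmin_l _ _)).
by rewrite e; apply: hb => //; apply: Rlt_le_trans sd (Rmin_r _ _).
Qed.

Lemma sol_local I J c f t : sol J c -> J t -> (exists delta, 0 < delta /\
    forall s, I s -> Rabs (s - t) < delta -> J s /\ f s = c s) -> f t = c t ->
  exists U l, [/\ unitary U, f t = sp U l, forall i, 0 < l i & mder I f t (vfield U l)].
Proof.
move=> hc Jt hl e; have [U [l [uU eU l0 hd]]] := hc t Jt.
exists U, l; split; [exact: uU|by rewrite e|exact: l0|exact: mder_local hl e hd].
Qed.

Lemma local_sol (e M : R) : 0 < e <= M -> exists r e', 0 < r /\ 0 < e' /\
  forall T A, spec_in A e M -> exists (a : nat -> E) d, d T = A /\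
    sol (fun t => Rabs (t - T) < r) d /\
    forall t, Rabs (t - T) < r -> mser (sc a (t - T)) (d t) /\ spec_ge (d t) e'.
Proof.
move=> eM; have [r [e' [r0 [e'0 H]]]] := local_flow hx hy eM.
exists r, e'; split => //; split => // T A [U [l [uU -> hl]]].
have [a [c [c0 hc]]] := H U l uU hl.
exists a, (fun t => c (t - T)); split; first by rewrite Rminus_diag.
split=> t ht.
  have [_ [V [m [uV eV hm hd]]]] := hc (t - T) (Rlt_le _ _ ht).
  exists V, m; split; [exact: uV|exact: eV| |].
    by move=> i; have := hm i; lra.
  by apply: mder_coords => b i j; apply: (is_derive_derw _ (hd ht b i j)).
have [h1 [V [m [uV eV hm _]]]] := hc (t - T) (Rlt_le _ _ ht).
by split; [exact: h1|exists V, m; split; [exact: uV|exact: eV|exact: hm]].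
Qed.

Lemma if_le (X : Type) (s t : R) (u v : X) : s <= t -> (if Rle_dec s t then u else v) = u.
Proof. by case: Rle_dec. Qed.
Lemma if_gt (X : Type) (s t : R) (u v : X) : t < s -> (if Rle_dec s t then u else v) = v.
Proof. by case: Rle_dec => // h1 h2; exfalso; lra. Qed.

Lemma sol_glue c d a T b : a <= T -> T < b -> sol (fun t => a <= t <= T) c ->
  sol (fun t => T <= t <= b) d -> d T = c T ->
  sol (fun t => a <= t <= b) (fun t => if Rle_dec t T then c t else d t).
Proof.
move=> aT Tb hc hd e t ht.
have [tT|[->|Tt]] := Rtotal_order t T.
- apply: (sol_local hc (t := t)); [lra| |by rewrite if_le //; lra].
  exists (T - t); split; first lra; move=> s hs /Rabs_lt_between hst.
  by split; [lra|rewrite if_le //; lra].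
- have h1 : a <= T <= T by lra.
  have h2 : T <= T <= b by lra.
  have [U [l [uU eU l0 hc']]] := hc T h1.
  (* At the seam both one-sided derivatives are expressed in the eigenbasis of [c T], so they are
     the same matrix. *)
  have hd' := sol_at hd h2 uU (etrans e eU) l0.
  have eT : (if Rle_dec T T then c T else d T) = c T by rewrite if_le //; lra.
  exists U, l; split; [exact: uU|by rewrite eT|exact: l0|].
  move=> eps e0; have [p [p0 hp]] := hc' eps e0; have [q [q0 hq]] := hd' eps e0.
  exists (Rmin p q); split; first exact: Rmin_pos.
  move=> s hs sd; rewrite eT; case: Rle_dec => sT.
    by apply: hp; [lra|apply: Rlt_le_trans sd (Rmin_l _ _)].
  by rewrite -e; apply: hq; [lra|apply: Rlt_le_trans sd (Rmin_r _ _)].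
- apply: (sol_local hd (t := t)); [lra| |by rewrite if_gt //; lra].
  exists (t - T); split; first lra; move=> s hs /Rabs_lt_between hst.
  by split; [lra|rewrite if_gt //; lra].
Qed.

Lemma sol_exists_upto t0 A e M : 0 < e -> spec_in A e M -> e <= M ->
  forall t1, t0 <= t1 -> exists c, sol (fun t => t0 <= t <= t1) c /\ c t0 = A.
Proof.
move=> e0 hA eM t1 t01.
have [r [e' [r0 [e'0 H]]]] := local_sol (conj e0 eM).
(* Half the radius, so that the closed step [[T, T + h]] lies inside the open domain of the local
   solution. *)
pose h := r / 2; have h0 : 0 < h by rewrite /h; lra.
suff key N : exists c, sol (fun t => t0 <= t <= t0 + INR N * h) c /\ c t0 = A.
  have [N hN] := INR_archimed h (t1 - t0) h0.
  have [c [hc ec]] := key N; exists c; split => //; apply: sol_sub hc => s; lra.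
elim: N => [|N [c [hc ec]]].
  have [U [l [uU eA hl]]] := hA.
  (* The interval is a single point, where every matrix is a derivative. *)
  exists (fun=> A); split => // t ht; exists U, l; split; [exact: uU|exact: eA| |].
    by move=> i; have := hl i; lra.
  move=> eps eps0; exists 1; split; first lra; move=> s hs _.
  have -> : s = t by move: ht hs; rewrite /=; lra.
  have -> : t - t = 0 by ring.
  rewrite subrr (rsc0 (vfield U l)) subrr fro0 Rabs_R0; lra.
pose T := t0 + INR N * h; have Nh : 0 <= INR N * h by apply: Rmult_le_pos; [exact: pos_INR|lra].
have t0T : t0 <= T by rewrite /T; lra.
have hT : spec_in (c T) e M.
  by apply: (spectrum_invariant hx hy t0T _ hc eM) => //; rewrite ec.
have [a [d [dT [hd _]]]] := H T _ hT.
exists (fun t => if Rle_dec t T then c t else d t); split.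
  have -> : t0 + INR N.+1 * h = T + h by rewrite S_INR /T; ring.
  apply: sol_glue => //; first lra.
  by apply: sol_sub hd => s hs; apply/Rabs_lt_between; rewrite /h in hs; lra.
by rewrite if_le.
Qed.

(** The two conditions on [I] cover bounded and unbounded intervals starting at [t0]; the maximum
    principle supplies the common lower bound needed for comparison. *)
Lemma sol_unique I c d t0 A e M : 0 < e <= M -> spec_in A e M ->
  (forall t, I t -> t0 <= t) -> (forall s t, t0 <= s <= t -> I t -> I s) ->
  sol I c -> sol I d -> c t0 = A -> d t0 = A -> forall t, I t -> c t = d t.
Proof.
move=> [e0 eM] hA hI hI2 hc hd ec ed t It.
have hI3 s : t0 <= s <= t -> I s by move=> hs; apply: hI2 It.
have hs s : t0 <= s <= t -> spec_ge (c s) e /\ spec_ge (d s) e.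
  move=> st; have h1 : t0 <= s by lra.
  have h2 u : t0 <= u <= s -> I u by move=> hu; apply: hI3; lra.
  split; apply: (spec_in_ge (M := M)).
    by apply: (spectrum_invariant hx hy h1 h2 hc eM); rewrite ec.
  by apply: (spectrum_invariant hx hy h1 h2 hd eM); rewrite ed.
by apply/(sol_eq_iff (hI t It) hI3 hc hd e0 hs); rewrite ec ed.
Qed.

Lemma sol_exists t0 A e M : 0 < e <= M -> spec_in A e M ->
  exists c, sol (fun t => t0 <= t) c /\ c t0 = A.
Proof.
move=> [e0 eM] hA.
pose P t1 c := sol (fun t => t0 <= t <= t1) c /\ c t0 = A.
pose C t1 := epsilon (inhabits (fun=> 0%R : E)) (P t1).
have hC t1 : t0 <= t1 -> P t1 (C t1).
  by move=> h; apply: epsilon_spec; apply: (sol_exists_upto e0 hA eM).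
(* The solution used at [t] runs up to [t + 1], so that on a two-sided neighbourhood uniqueness
   identifies the diagonal choice with it. *)
exists (fun t => C (t + 1) t); split; last first.
  by have /hC[_ ->] : t0 <= t0 + 1 by lra.
move=> t ht.
have h1 : t0 <= t + 1 by lra.
have [hs1 he1] := hC _ h1.
apply: (sol_local (f := fun t => C (t + 1) t) hs1 (t := t)); [lra| |by []].
exists 1; split; first lra; move=> s hs /Rabs_lt_between hst; split; first lra.
have h2 : t0 <= s + 1 by lra.
have [hs2 he2] := hC _ h2.
have k1 : forall u, t0 <= u <= s -> t0 <= u by move=> u; lra.
have k2 : forall u v, t0 <= u <= v -> t0 <= v <= s -> t0 <= u <= s by move=> u v; lra.
have k3 : t0 <= s <= s by lra.
apply: (sol_unique (conj e0 eM) hA k1 k2 _ _ he2 he1 k3).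
  by apply: sol_sub hs2 => u hu; lra.
by apply: sol_sub hs1 => u hu; lra.
Qed.

Lemma sol_analytic c t0 A e M : 0 < e <= M -> spec_in A e M ->
  sol (fun t => t0 <= t) c -> c t0 = A -> forall t2, t0 <= t2 ->
  exists r, 0 < r /\ exists a : nat -> E, forall t, t0 <= t -> Rabs (t - t2) < r ->
    mser (sc a (t - t2)) (c t).
Proof.
move=> [e0 eM] hA hc ec t2 ht2.
have hcs t : t0 <= t -> spec_in (c t) e M.
  move=> ht; have hI u : t0 <= u <= t -> t0 <= u by lra.
  by apply: (spectrum_invariant hx hy ht hI hc eM); rewrite ec.
have [r [e' [r0 [e'0 H]]]] := local_sol (conj e0 eM).
have [a [d [dT [hd hda]]]] := H t2 _ (hcs t2 ht2).
exists r; split => //; exists a => t ht htr.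
have [hser _] := hda t htr.
suff -> : c t = d t by exact: hser.
pose I s := t0 <= s /\ Rabs (s - t2) < r.
have hc' : sol I c by apply: sol_sub hc => s [].
have hd' : sol I d by apply: sol_sub hd => s [].
(* The bound [e] holds for [c] by the maximum principle, and [e'] for [d] by construction; [d] is
   also compared at times before its centre, where the maximum principle from [t2] does not
   reach. *)
have m0 : 0 < Rmin e e' by apply: Rmin_pos.
have hs s : I s -> spec_ge (c s) (Rmin e e') /\ spec_ge (d s) (Rmin e e').
  move=> [h1 h2]; split.
    by apply: spec_ge_le (Rmin_l _ _) _; apply: spec_in_ge (hcs s h1).
  by apply: spec_ge_le (Rmin_r _ _) _; have [] := hda s h2.
have /Rabs_lt_between htr' := htr.
have [h|h] := Rle_lt_dec t t2.
  have hI u : t <= u <= t2 -> I u by move=> hu; split; [lra|apply/Rabs_lt_between; lra].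
  by apply/(sol_eq_iff h hI hc' hd' m0 (fun u hu => hs u (hI u hu))); rewrite dT.
have hI u : t2 <= u <= t -> I u by move=> hu; split; [lra|apply/Rabs_lt_between; lra].
by apply/(sol_eq_iff (Rlt_le _ _ h) hI hc' hd' m0 (fun u hu => hs u (hI u hu))); rewrite dT.
Qed.

Lemma vfield_lip U V l m e : unitary U -> unitary V -> 0 < e ->
  (forall i, e <= l i) -> (forall i, e <= m i) ->
  fro (vfield U l - vfield V m) <= kap x y / e * fro (sp U l - sp V m).
Proof.
move=> uU uV e0 hl hm; rewrite /vfield -opprD froN -lapmN -lapmD.
apply: Rle_trans (fro_lapm _ _ _) _; rewrite /Rdiv Rmult_assoc.
by apply: Rmult_le_compat_l (kap_ge0 _ _) _; exact: sp_ln_lip.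
Qed.

(** The derivative is the vector field along a continuous curve, and the field is Lipschitz there
    because the maximum principle gives one lower spectral bound for all times. *)
Lemma sol_C1 I c D t0 A e M : 0 < e <= M -> spec_in A e M ->
  (forall t, I t -> t0 <= t) -> (forall s t, t0 <= s <= t -> I t -> I s) ->
  sol I c -> c t0 = A ->
  (forall t, I t -> exists U l, [/\ unitary U, c t = sp U l & D t = vfield U l]) ->
  forall t b i j, I t -> contw I (fun s => coord b i j (D s)) t.
Proof.
move=> [e0 eM] hA hI hI2 hc ec hD t b i j It eps eps0.
have low s U l : I s -> unitary U -> c s = sp U l -> forall k, e <= l k.
  move=> Is uU eU; have hJ u : t0 <= u <= s -> I u by move=> hu; apply: hI2 Is.
  have := spectrum_invariant hx hy (hI s Is) hJ hc eM; rewrite ec => /(_ hA) [V [m [uV eV hm]]] k.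
  by have [] := spectrum_bounds uV uU (etrans (esym eV) eU) hm k.
have [V [m [uV eV m0 hd]]] := hc t It.
have [dl [dl0 hdl]] := mder_lipschitz hd.
have hk : 0 <= kap x y / e by apply: Rdiv_le_0_compat; [exact: kap_ge0|].
have f0 := fro_ge0 (vfield V m).
pose K := kap x y / e * (fro (vfield V m) + 1).
have K0 : 0 <= K by apply: Rmult_le_pos => //; lra.
have q0 : 0 < eps / (K + 1) by apply: Rdiv_lt_0_compat; lra.
exists (Rmin dl (eps / (K + 1))); split; first exact: Rmin_pos.
move=> s Is sd.
have h1 := hdl s Is (Rlt_le_trans _ _ _ sd (Rmin_l _ _)).
have h2 := Rlt_le_trans _ _ _ sd (Rmin_r _ _).
have [Us [ls [uUs eUs ->]]] := hD s Is; have [Ut [lt [uUt eUt ->]]] := hD t It.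
rewrite -coord_sub; apply: Rle_lt_trans (coord_le_fro _ _ _ _) _.
apply: Rle_lt_trans (vfield_lip uUs uUt e0 (low _ _ _ Is uUs eUs) (low _ _ _ It uUt eUt)) _.
rewrite -eUs -eUt.
have h3 := Rmult_le_compat_l _ _ _ hk h1.
have h4 : (K + 1) * Rabs (s - t) < eps.
  by rewrite Rmult_comm; apply/Rlt_div_r => //; lra.
have := Rabs_pos (s - t); rewrite /K in h4 *; lra.
Qed.
End Existence.

(** * Back to matrices indexed by natural numbers *)

Section Transport.
Variable n : nat.
Local Notation E := (Mx n).
Implicit Types (a A B : Defs.Mat).

Definition toM A : E := of_coords (fun b i j => if b then Defs.Cre (A i j) else Defs.Cim (A i j)).
Definition ofM (X : E) : Defs.Mat := fun i j =>
  match insub i, insub j with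
  | Some i', Some j' => (coord true i' j' X, coord false i' j' X)
  | _, _ => Defs.C0
  end.

Lemma coord_toM b i j A : coord b i j (toM A) = if b then Defs.Cre (A i j) else Defs.Cim (A i j).
Proof. exact: coord_of_coords. Qed.
Lemma toM_ofM X : toM (ofM X) = X.
Proof.
by apply: coord_inj => b i j; rewrite coord_toM /ofM !valK; case: b.
Qed.
Lemma Cpair_eq (z w : Defs.C) : Defs.Cre z = Defs.Cre w -> Defs.Cim z = Defs.Cim w -> z = w.
Proof. by case: z => ? ?; case: w => ? ? /= -> ->. Qed.
Lemma meqP A B : Defs.meq n A B <-> toM A = toM B.
Proof.
split=> [h|h i j /ssrnat.ltP hi /ssrnat.ltP hj].
  apply: coord_inj => b i j; rewrite !coord_toM.
  by rewrite (h i j) //; apply/ssrnat.ltP.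
have h1 := congr1 (coord true (Ordinal hi) (Ordinal hj)) h.
have h2 := congr1 (coord false (Ordinal hi) (Ordinal hj)) h.
by rewrite !coord_toM in h1 h2; apply: Cpair_eq.
Qed.

Definition toC (z : Defs.C) : Rf[i] := ((Defs.Cre z : Rf) +i* Defs.Cim z)%C.
Lemma toME A i j : toM A i j = toC (A i j). Proof. by rewrite mxE. Qed.
Lemma toC_mul z w : toC (Defs.Cmul z w) = (toC z * toC w)%R. Proof. by []. Qed.
Lemma toC_add z w : toC (Defs.Cadd z w) = (toC z + toC w)%R. Proof. by []. Qed.
Lemma toC_inj : injective toC.
Proof. by move=> [a b] [c d] []; rewrite /= => -> ->. Qed.
Lemma toC_sum k f : toC (Defs.Csum k f) = (\sum_(l < k) toC (f l))%R.
Proof. by elim: k => [|k IH]; rewrite ?big_ord0 // big_ord_recr /= toC_add IH. Qed.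

Lemma toM_mul A B : toM (Defs.mmul n A B) = (toM A *m toM B)%R.
Proof.
apply/matrixP => i j; rewrite toME toC_sum mxE; apply: eq_bigr => k _.
by rewrite toC_mul !toME.
Qed.
Lemma toM_add A B : toM (Defs.madd A B) = (toM A + toM B)%R.
Proof. by apply/matrixP => i j; rewrite toME [RHS]mxE !toME. Qed.
Lemma toM_opp A : toM (Defs.mopp A) = (- toM A)%R.
Proof. by apply/matrixP => i j; rewrite toME [RHS]mxE !toME. Qed.
Lemma toM_adj A : toM (Defs.madj A) = adj (toM A).
Proof. by apply/matrixP => i j; rewrite adjE !toME. Qed.
Lemma toM_id : toM Defs.mid = 1%:M%R.
Proof.
apply/matrixP => i j; rewrite toME mxE /Defs.mid; case: Nat.eq_dec => h.
  by rewrite (ord_inj h) eqxx.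
by case: eqP => // e; case: h; rewrite e.
Qed.
Lemma toM_diag (l : nat -> R) : toM (Defs.mdiag (fun k => Defs.Cof (l k))) = dg (fun i => l i).
Proof.
apply/matrixP => i j; rewrite toME dgE /Defs.mdiag; case: Nat.eq_dec => h.
  by rewrite (ord_inj h) eqxx.
by case: eqP => // e; case: h; rewrite e.
Qed.
Lemma toM_comm A B : toM (Defs.comm n A B) = com (toM A) (toM B).
Proof. by rewrite /Defs.comm /Defs.msub toM_add toM_opp !toM_mul. Qed.
Lemma toM_lap A B a : toM (Defs.lap n A B a) = lapm (toM A) (toM B) (toM a).
Proof. by rewrite /Defs.lap toM_add !toM_comm. Qed.
Lemma unitaryP A : Defs.is_unitary n A <-> unitary (toM A).
Proof. by rewrite /Defs.is_unitary !meqP !toM_mul toM_adj toM_id. Qed.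
Lemma hermitianP A : Defs.is_hermitian n A <-> adj (toM A) = toM A.
Proof. by rewrite /Defs.is_hermitian meqP toM_adj. Qed.
Lemma diagonalizesP A (l : nat -> R) B : Defs.diagonalizes n A l B <->
  unitary (toM A) /\ toM B = sp (toM A) (fun i => l i).
Proof. by rewrite /Defs.diagonalizes unitaryP meqP !toM_mul toM_adj toM_diag. Qed.

(** The diagonalization hidden in [mlog] is an arbitrary choice, so it is exposed existentially;
    [rhsP] then replaces it by any other. *)
Lemma mlogP A : adj (toM A) = toM A -> exists U l, [/\ unitary U, toM A = sp U l &
  toM (Defs.mlog n A) = sp U (fun i => ln (l i))].
Proof.
move=> hA; rewrite /Defs.mlog /Defs.mfun.
have ex : exists p : Defs.Mat * (nat -> R), Defs.diagonalizes n p.1 p.2 A.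
  have [U [l [uU e]]] := hermitian_spectral hA.
  exists (ofM U, fun k => if insub k is Some i then l i else 0); apply/diagonalizesP => /=.
  by rewrite toM_ofM e; split; [exact: uU|]; apply: eq_sp => i; rewrite valK.
case: excluded_middle_informative => // h.
have /= := epsilon_spec (inhabits (Defs.mzero, fun=> 0)) _ ex.
set p := epsilon _ _ => /diagonalizesP [uU e].
by exists (toM p.1), (fun i => p.2 i); split; [exact: uU|exact: e|]; rewrite !toM_mul toM_adj toM_diag.
Qed.

Lemma sum_delta_col (U : E) (l : 'I_n -> R) (i k : 'I_n) : unitary U ->
  (\sum_j sp U l k j * U j i = ((l i : Rf)%:C)%C * U k i)%R.
Proof.
move=> [U1 _]; have : (sp U l *m U = U *m dg l)%R by rewrite /HermitianMatrices.sp -!mulmxA U1 mulmx1.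
by move=> /matrixP/(_ k i); rewrite mxE mul_dgr mulrC.
Qed.

Lemma posP A : Defs.is_pos n A <-> exists U l, [/\ unitary U, toM A = sp U l & forall i, 0 < l i].
Proof.
split.
  move=> [/hermitianP /hermitian_spectral [U [l [uU e]]] hev]; exists U, l; split => // i.
  apply: (proj2 (hev (Defs.Cof (l i)) _)).
  (* The [i]-th column of [U], an eigenvector for [l i]. *)
  pose w k : Defs.C := ofM U k i.
  have wE (k : 'I_n) : toC (w k) = U k i by rewrite /w -toME toM_ofM.
  exists w; split.
    case: (classic (exists k, (k < n)%coq_nat /\ w k <> Defs.C0)) => // hno.
    exfalso; have w0 (k : 'I_n) : U k i = 0%R.
      rewrite -wE; have -> // : w k = Defs.C0.
      by apply: NNPP => hk; apply: hno; exists k; split => //; apply/ssrnat.ltP.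
    case: uU => /matrixP/(_ i i) + _; rewrite !mxE eqxx big1 => [/eqP|k _].
      by rewrite eq_sym oner_eq0.
    by rewrite w0 mulr0.
  move=> k /ssrnat.ltP hk; apply: toC_inj; rewrite toC_mul toC_sum.
  have := sum_delta_col l i (Ordinal hk) uU; rewrite -e -(wE (Ordinal hk)) => <-.
  by apply: eq_bigr => j _; rewrite toC_mul -wE toME.
move=> [U [l [uU e l0]]]; split; first by apply/hermitianP; rewrite e adj_sp.
move=> lam [w [[i [/ssrnat.ltP hi wi]] hw]].
(* The eigenvector is repeated in every column, to stay within square matrices; a nonzero entry of
   [adj U *m W] in row [k] then forces [lam] to be [l k]. *)
pose W : E := (\matrix_(k, j) toC (w k))%R.
have eW : (sp U l *m W = toC lam *: W)%R.
  apply/matrixP => k j; rewrite -e mxE [RHS]mxE [W k j]mxE -toC_mul -hw; last exact/ssrnat.ltP.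
  by rewrite toC_sum; apply: eq_bigr => k' _; rewrite [W _ _]mxE toME toC_mul.
pose Y : E := (adj U *m W)%R.
have eY : (dg l *m Y = toC lam *: Y)%R.
  have [U1 _] := uU; have := congr1 (mulmx (adj U)) eW.
  by rewrite /HermitianMatrices.sp -scalemxAr !mulmxA U1 mul1mx -mulmxA.
have [k [j hY]] : exists k j, Y k j != 0%R.
  apply: NNPP => hno; have Y0 : Y = 0%R.
    by apply/matrixP => k j; rewrite [RHS]mxE; apply/eqP/negPn/negP => h; apply: hno; exists k, j.
  have : W = 0%R by rewrite -[W]mul1mx; case: uU => _ <-; rewrite -mulmxA -/Y Y0 mulmx0.
  move=> /matrixP/(_ (Ordinal hi) (Ordinal hi)); rewrite !mxE => h; apply: wi.
  by apply: toC_inj; rewrite [LHS]h.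
have := congr1 (fun X : E => X k j) eY; rewrite mul_dgl [RHS]mxE => /(mulIf hY).
move=> /(@toC_inj (Defs.Cof (l k))) <-.
by split; [|exact: l0].
Qed.

Lemma derw_ext I f g t l : (forall s, f s = g s) -> derw I f t l -> derw I g t l.
Proof.
move=> fg h eps e0; have [d [d0 hd]] := h eps e0; exists d; split=> // s.
by rewrite -!fg; apply: hd.
Qed.
Lemma contw_ext I f g t : (forall s, f s = g s) -> contw I f t -> contw I g t.
Proof.
move=> fg h eps e0; have [d [d0 hd]] := h eps e0; exists d; split=> // s.
by rewrite -!fg; apply: hd.
Qed.
Lemma mderivP I (c : R -> Defs.Mat) t D : Defs.mderiv_within n I c t D <->
  forall b i j, derw I (fun s => coord b i j (toM (c s))) t (coord b i j (toM D)).
Proof.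
split=> [h b i j|h i j /ssrnat.ltP hi /ssrnat.ltP hj].
  rewrite coord_toM; have [h1 h2] := h i j (elimT ssrnat.ltP (ltn_ord i)) (elimT ssrnat.ltP (ltn_ord j)).
  by case: b; [apply: derw_ext h1|apply: derw_ext h2] => s; rewrite coord_toM.
have h1 := h true (Ordinal hi) (Ordinal hj); have h2 := h false (Ordinal hi) (Ordinal hj).
rewrite !coord_toM in h1 h2.
by split; [apply: derw_ext h1|apply: derw_ext h2] => s; rewrite coord_toM.
Qed.
Lemma mcontP I (c : R -> Defs.Mat) t :
  (forall b i j, contw I (fun s => coord b i j (toM (c s))) t) -> Defs.mcont_within n I c t.
Proof.
move=> h i j /ssrnat.ltP hi /ssrnat.ltP hj.
have h1 := h true (Ordinal hi) (Ordinal hj); have h2 := h false (Ordinal hi) (Ordinal hj).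
by split; [apply: contw_ext h1|apply: contw_ext h2] => s; rewrite coord_toM.
Qed.

Variables (x y : Defs.Mat).
Hypotheses (hx : Defs.is_hermitian n x) (hy : Defs.is_hermitian n y).
Let hx' := proj1 (hermitianP x) hx.
Let hy' := proj1 (hermitianP y) hy.
Local Notation sol := (sol (toM x) (toM y)).

Lemma rhsP A U l : unitary U -> toM A = sp U l -> (forall i, 0 < l i) ->
  toM (Defs.mopp (Defs.lap n x y (Defs.mlog n A))) = vfield (toM x) (toM y) U l.
Proof.
move=> uU e l0; have hA : adj (toM A) = toM A by rewrite e adj_sp.
have [V [m [uV e' eL]]] := mlogP hA.
have [e1 [M1 [[e10 _] hb]]] := finite_positive_bound l0.
have m0 i : 0 < m i.
  have [h _] := spectrum_bounds uU uV (etrans (esym e) e') hb i; exact: Rlt_le_trans e10 h.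
by rewrite toM_opp toM_lap eL /vfield (sp_ln_eq uV uU m0 l0) // -e -e'.
Qed.

Lemma ricci_sol I t0 c0 c : Defs.ricci_solution n x y I t0 c0 c ->
  sol I (fun t => toM (c t)) /\ toM (c t0) = toM c0.
Proof.
move=> [_ [hpos [h0 hd]]]; split; last exact/meqP.
move=> t It; have [U [l [uU e l0]]] := proj1 (posP (c t)) (hpos t It).
exists U, l; split; [exact: uU|exact: e|exact: l0|].
by apply: mder_coords => b i j; rewrite -(rhsP uU e l0); apply: (proj1 (mderivP _ _ _ _) (hd t It)).
Qed.

Lemma sol_ricci I t0 c0 e M c : 0 < e <= M -> spec_in (toM c0) e M ->
  (forall t, I t -> t0 <= t) -> (forall s t, t0 <= s <= t -> I t -> I s) ->
  sol I c -> c t0 = toM c0 -> Defs.ricci_solution n x y I t0 c0 (fun t => ofM (c t)).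
Proof.
move=> eM hc0 hI hI2 hc ec; pose c' t := Defs.mopp (Defs.lap n x y (Defs.mlog n (ofM (c t)))).
have hd t : I t -> Defs.mderiv_within n I (fun t => ofM (c t)) t (c' t).
  move=> It; have [U [l [uU eU l0 hd]]] := hc t It; apply/mderivP => b i j.
  rewrite /c' (rhsP uU _ l0) ?toM_ofM //.
  by apply: derw_ext (mder_coord b i j hd) => s; rewrite toM_ofM.
split; [|split; [|split]].
- exists c'; split => // t It; apply: mcontP => b i j.
  apply: (sol_C1 hx' hy' (D := fun s => toM (c' s)) eM hc0 hI hI2 hc ec _ b i j It) => s Is.
  have [U [l [uU eU l0 _]]] := hc s Is; exists U, l; split; [exact: uU|exact: eU|].
  by rewrite /c' (rhsP uU _ l0) ?toM_ofM.
- move=> t It; apply/posP; have [U [l [uU eU l0 _]]] := hc t It.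
  by exists U, l; rewrite toM_ofM.
- by apply/meqP; rewrite toM_ofM.
- exact: hd.
Qed.

Lemma is_pos_spec_in c0 : Defs.is_pos n c0 -> exists e M, 0 < e <= M /\ spec_in (toM c0) e M.
Proof.
move=> /posP [U [l [uU eU l0]]]; have [e [M [eM h]]] := finite_positive_bound l0.
by exists e, M; split => //; exists U, l.
Qed.

Lemma ricci_unique I t0 c0 c d : Defs.is_pos n c0 ->
  (forall t, I t -> t0 <= t) -> (forall s t, t0 <= s <= t -> I t -> I s) ->
  Defs.ricci_solution n x y I t0 c0 c -> Defs.ricci_solution n x y I t0 c0 d ->
  forall t, I t -> Defs.meq n (c t) (d t).
Proof.
move=> /is_pos_spec_in [e [M [eM hA]]] hI hI2 /ricci_sol [hc ec] /ricci_sol [hd ed] t It.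
apply/meqP; exact: (sol_unique hx' hy' eM hA hI hI2 hc hd ec ed It).
Qed.

Lemma ricci_exists I t0 c0 : Defs.is_pos n c0 ->
  (forall t, I t -> t0 <= t) -> (forall s t, t0 <= s <= t -> I t -> I s) ->
  exists c, Defs.ricci_solution n x y I t0 c0 c.
Proof.
move=> /is_pos_spec_in [e [M [eM hA]]] hI hI2.
have [c [hc ec]] := sol_exists hx' hy' t0 eM hA.
exists (fun t => ofM (c t)); apply: (sol_ricci eM hA hI hI2 _ ec).
exact: sol_sub hc.
Qed.

Lemma ricci_analytic t0 c0 c : Defs.is_pos n c0 ->
  Defs.ricci_solution n x y (fun t => t0 <= t) t0 c0 c -> forall t2, t0 <= t2 ->
  exists eps, 0 < eps /\ exists a : nat -> Defs.Mat, forall t, t0 <= t -> Rabs (t - t2) < eps ->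
    forall i j, (i < n)%coq_nat -> (j < n)%coq_nat ->
    Un_cv (fun N => sum_f_R0 (fun k => Defs.Cre (a k i j) * (t - t2) ^ k) N) (Defs.Cre (c t i j)) /\
    Un_cv (fun N => sum_f_R0 (fun k => Defs.Cim (a k i j) * (t - t2) ^ k) N) (Defs.Cim (c t i j)).
Proof.
move=> /is_pos_spec_in [e [M [eM hA]]] /ricci_sol [hc ec] t2 ht2.
have [r [r0 [a ha]]] := sol_analytic hx' hy' eM hA hc ec ht2.
exists r; split => //; exists (fun k => ofM (a k)) => t ht htr i j /ssrnat.ltP hi /ssrnat.ltP hj.
have h b : Un_cv (fun N => sum_f_R0 (fun k => coord b (Ordinal hi) (Ordinal hj) (a k) * (t - t2) ^ k) N)
   (coord b (Ordinal hi) (Ordinal hj) (toM (c t))).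
  have h1 := @mser_coord _ _ _ b (Ordinal hi) (Ordinal hj) (ha t ht htr).
  apply/is_series_Reals; apply: (is_series_ext _ _ _ _ h1) => k.
  by rewrite coord_scal; exact: Rmult_comm.
have eI : insub i = Some (Ordinal hi) by rewrite insubT.
have eJ : insub j = Some (Ordinal hj) by rewrite insubT.
have h1 := h true; have h2 := h false; rewrite !coord_toM in h1 h2.
by rewrite /ofM eI eJ.
Qed.
End Transport.

End RicciFlow.

Theorem theorem3p1 (n m : nat) (hn : (2 <= n)%nat) (hm1 : (1 <= m)%nat)
  (hm2 : (m <= n - 1)%nat) (hgcd : Nat.gcd m n = 1%nat)
  (u v x y : Mat)
  (hu : is_unitary n u) (hv : is_unitary n v) (hgen : generates n u v)
  (hvu : meq n (mmul n v u) (mscale (qroot n m) (mmul n u v)))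
  (hx : is_hermitian n x) (hy : is_hermitian n y)
  (hux : meq n u (mexpi n (2 * PI / INR n) x))
  (hvy : meq n v (mexpi n (2 * PI / INR n) y))
  (t0 : R) (c0 : Mat) (hc0 : is_pos n c0) :
  (forall t1 : R, t0 <= t1 ->
     (exists c : R -> Mat, ricci_solution n x y (fun t => t0 <= t <= t1) t0 c0 c) /\
     (forall c c' : R -> Mat,
        ricci_solution n x y (fun t => t0 <= t <= t1) t0 c0 c ->
        ricci_solution n x y (fun t => t0 <= t <= t1) t0 c0 c' ->
        forall t, t0 <= t <= t1 -> meq n (c t) (c' t))) /\
  ((exists c : R -> Mat, ricci_solution n x y (fun t => t0 <= t) t0 c0 c) /\
   (forall c c' : R -> Mat,
      ricci_solution n x y (fun t => t0 <= t) t0 c0 c ->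
      ricci_solution n x y (fun t => t0 <= t) t0 c0 c' ->
      forall t, t0 <= t -> meq n (c t) (c' t))) /\
  (forall c : R -> Mat,
     ricci_solution n x y (fun t => t0 <= t) t0 c0 c ->
     forall t2 : R, t0 <= t2 ->
       exists eps : R, 0 < eps /\
       exists a : nat -> Mat,
         forall t : R, t0 <= t -> Rabs (t - t2) < eps ->
           forall i j : nat, (i < n)%nat -> (j < n)%nat ->
             Un_cv (fun N => sum_f_R0 (fun k => Cre (a k i j) * (t - t2) ^ k) N)
                   (Cre (c t i j)) /\
             Un_cv (fun N => sum_f_R0 (fun k => Cim (a k i j) * (t - t2) ^ k) N)
                   (Cim (c t i j))).
Proof.
split; [intros t1 ht|split; [split|]].
- split.
  + refine (@RicciFlow.ricci_exists n x y hx hy (fun t => t0 <= t <= t1) t0 c0 hc0 _ _);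
    intros; lra.
  + intros c d; refine (@RicciFlow.ricci_unique n x y hx hy (fun t => t0 <= t <= t1) t0 c0 c d hc0 _ _); intros; lra.
- refine (@RicciFlow.ricci_exists n x y hx hy (fun t => t0 <= t) t0 c0 hc0 _ _); intros; lra.
- intros c d; refine (@RicciFlow.ricci_unique n x y hx hy (fun t => t0 <= t) t0 c0 c d hc0 _ _); intros; lra.
- intros c; exact (@RicciFlow.ricci_analytic n x y hx hy t0 c0 c hc0).
Qed.
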